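(* Let $\Phi,\Psi\in L^\infty_{M_n}$ be of bounded type. If $\Phi$ or $\Psi$ has a tensored-scalar singularity, then $$H_\Psi H_\Phi=0\ \Longrightarrow\ H_\Phi=0\ \text{ or }\ H_\Psi=0.$$
   Context: $L^\infty_{M_n}$ is the space of bounded measurable $n\times n$ matrix functions on the unit circle $\mathbb T$; $H^2_{\mathbb C^n}\subset L^2_{\mathbb C^n}$ is the $\mathbb C^n$-valued Hardy space. A matrix function is of bounded type if each entry equals a.e. on $\mathbb T$ a quotient of two $H^\infty$ functions. For $\Phi\in L^\infty_{M_n}$ the Hankel operator $H_\Phi:H^2_{\mathbb C^n}\to H^2_{\mathbb C^n}$ is $H_\Phi f=J_nP_n^\perp(\Phi f)$, where $P_n^\perp$ is the orthogonal projection of $L^2_{\mathbb C^n}$ onto $(H^2_{\mathbb C^n})^\perp$ and $(J_nf)(z)=\overline z f(\overline z)$. A bounded type $\Phi\in L^\infty_{M_n}$ has a tensored-scalar singularity if there is a nonconstant scalar inner function $\theta$ with $\ker H_\Phi\subseteq\theta H^2_{\mathbb C^n}$. *)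

(* Defs.v *)
From mathcomp Require Import all_boot all_order all_algebra.
From mathcomp Require Import complex.
From mathcomp Require Import all_classical all_reals all_analysis.

Set Implicit Arguments.
Unset Strict Implicit.
Unset Printing Implicit Defensive.

Import Order.TTheory GRing.Theory Num.Theory.

Local Open Scope classical_set_scope.
Local Open Scope ring_scope.

(* Functions on the unit circle are total functions on R[i]; every notion below
   depends only on their values at the points cis t. As usual, elements of
   L^p and H^p are identified when they agree almost everywhere; this is made
   explicit through aeT and eqT. *)

Definition cis (R : realType) (t : R) : R[i] := (cos t +i* sin t)%C.

Lemma two_pi_gt0 (R : realType) : 0 < 2 * pi :> R.
Proof. by rewrite mulr_gt0// pi_gt0. Qed.

(* Normalized Lebesgue measure on the circle, in the angular variable. *)
Notation arc R := (uniform_prob (two_pi_gt0 R)).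

Definition aeT (R : realType) (P : set R[i]) : Prop :=
  {ae arc R, forall t, P (cis t)}.

Definition eqT (R : realType) (V : Type) (f g : R[i] -> V) : Prop :=
  aeT [set z | f z = g z].

Definition reT (R : realType) (f : R[i] -> R[i]) (t : R) : R :=
  complex.Re (f (cis t)).

Definition imT (R : realType) (f : R[i] -> R[i]) (t : R) : R :=
  complex.Im (f (cis t)).

Definition intT (R : realType) (f : R[i] -> R[i]) : R[i] :=
  ((\int[arc R]_t reT f t) +i* (\int[arc R]_t imT f t))%C.

Section scalar.
Context {R : realType}.
Implicit Types (f : R[i] -> R[i]) (p : \bar R).

Definition LT p : set (R[i] -> R[i]) :=
  [set f : R[i] -> R[i] |
    reT f \in Lfun (arc R) p /\ imT f \in Lfun (arc R) p].

Definition fourier f (k : int) : R[i] := intT (fun z => f z * ((z ^ k)^*)%C).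

Definition HT p : set (R[i] -> R[i]) :=
  [set f | LT p f /\ forall k : int, (k < 0)%R -> fourier f k = 0].

Definition inner_function : set (R[i] -> R[i]) :=
  [set theta | HT +oo%E theta /\ aeT [set z | `|theta z| = 1]].

Definition nonconstant f : Prop := ~ exists c : R[i], eqT f (fun=> c).

Definition bounded_type f : Prop :=
  exists u v, [/\ HT +oo%E u, HT +oo%E v &
    aeT [set z | v z != 0 /\ f z = u z / v z]].

End scalar.

Section vector.
Context {R : realType} {n : nat}.
Local Notation C := R[i].
Local Notation vfun := (C -> 'cV[C]_n).
Local Notation mfun := (C -> 'M[C]_n).
Implicit Types (f g h : vfun) (M : set vfun) (Phi : mfun).

Definition L2 : set vfun := [set f | forall i, LT 2%:E (fun z => f z i 0)].

Definition H2 : set vfun := [set f | forall i, HT 2%:E (fun z => f z i 0)].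

Definition Linf : set mfun :=
  [set Phi | forall i j, LT +oo%E (fun z => Phi z i j)].

Definition bounded_type_mx Phi : Prop :=
  forall i j, bounded_type (fun z => Phi z i j).

Definition dot f g : C := intT (fun z => \sum_i f z i 0 * ((g z i 0)^*)%C).

Definition orth M : set vfun :=
  [set g | L2 g /\ forall k, M k -> dot g k = 0].

(* Orthogonal projection of L2 onto a closed subspace M: the element g of M,
   unique up to eqT, such that h - g is orthogonal to M. *)
Definition orth_proj M h : vfun :=
  xget (fun=> 0) [set g | M g /\ orth M (fun z => h z - g z)].

Definition flip f : vfun := fun z => (z^*)%C *: f (z^*)%C.

Definition hankel Phi f : vfun :=
  flip (orth_proj (orth H2) (fun z => Phi z *m f z)).

(* The operator A on H2 is zero. *)
Definition zero_op (A : vfun -> vfun) : Prop :=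
  forall f, H2 f -> eqT (A f) (fun=> 0).

Definition ker_hankel Phi : set vfun :=
  [set f | H2 f /\ eqT (hankel Phi f) (fun=> 0)].

Definition mulH2 (theta : C -> C) : set vfun :=
  [set f | exists2 g, H2 g & eqT f (fun z => theta z *: g z)].

Definition tensored_scalar_singularity Phi : Prop :=
  exists theta : C -> C, [/\ inner_function theta, nonconstant theta &
    ker_hankel Phi `<=` mulH2 theta].

End vector.

(* Main.v *)
Require Import Defs.
From mathcomp Require Import all_boot all_order all_algebra.
From mathcomp Require Import complex ring lra.
From mathcomp Require Import all_classical all_reals all_analysis.
From mathcomp Require Import measurable_realfun ess_sup_inf.

(** Let Psi, Phi be such that H_Psi H_Phi = 0, and let W be the set of constant
    vectors H_Phi f (0), for f in H^2. The range of H_Phi is invariant under the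
    backward shift S*, and the kernel of H_Psi under the shift S; writing
    g = g(0) + z S* g for g = H_Phi f, one sees that H_Psi kills the constant
    function g(0) as well [hankel_value_ker]. So W is contained in ker H_Psi. On
    the other hand every negative Fourier coefficient of Phi f is an element of W,
    so that W = 0 means H_Phi = 0.

    Suppose that ker H_Psi is contained in theta H^2. Then so is W; but a nonzero
    constant c = theta g would make conj theta = g / c analytic, and theta constant
    [const_not_divisible]. Hence W = 0 and H_Phi = 0.

    Suppose that ker H_Phi is contained in theta H^2, and that H_Psi is not zero.
    Some row r of negative coefficients of Psi, of index -k say, is then nonzero,
    and r w = 0 for all w in W since H_Psi w = 0. In other words r Phi f is analytic
    for all f. If i0 is an index with r i0 <> 0 and x is such that all entries of
    Phi x but the one of index i0 vanish, then the remaining entry is analytic and x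
    lies in ker H_Phi. So x = theta y, where y satisfies the same equations, and
    x is divisible by every power of theta; this forces x = 0, because
    |theta^(0)| < 1 [divisible_eq0]. But the n - 1 equations in n unknowns that
    define x have a nonzero solution over the quotient field of H^oo, in which
    the entries of Phi lie [bounded_type_null_vector].

    All this is carried out on Fourier coefficients. The coefficients of H_Phi f
    are the negative ones of Phi f in reverse order [hankelP], once the orthogonal
    projection is known to exist, which is the theorem of Riesz and Fischer
    [riesz_fischer]. Products of Hardy functions are controlled by the
    orthogonality of functions with disjoint spectra
    [disjoint_spectrum_orthogonal], which follows from the L^2-convergence of
    Fourier series, itself a consequence of the Riesz-Fischer theorem and of the
    uniqueness of Fourier coefficients [fourier_inj]. Uniqueness is proved with
    explicit trigonometric polynomials that converge boundedly to indicator
    functions of arcs, and Lebesgue's differentiation theorem. *)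

Set Implicit Arguments.
Unset Strict Implicit.
Unset Printing Implicit Defensive.

Import Order.TTheory GRing.Theory Num.Theory.
Import numFieldNormedType.Exports.

Local Open Scope classical_set_scope.
Local Open Scope ring_scope.


(** * Complex numbers on the unit circle *)

Section ComplexParts.
Context {R : realType}.
Local Notation C := R[i].
Implicit Types (x y z : C).

(** Real-valued, unlike [`|z| ^+ 2], so that it can be integrated. *)
Definition sqmod (z : C) : R := complex.Re z ^+ 2 + complex.Im z ^+ 2.

Lemma ReD x y : complex.Re (x + y) = complex.Re x + complex.Re y.
Proof. by case: x => a b; case: y. Qed.
Lemma ImD x y : complex.Im (x + y) = complex.Im x + complex.Im y.
Proof. by case: x => a b; case: y. Qed.
Lemma ReN x : complex.Re (- x) = - complex.Re x. Proof. by case: x. Qed.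
Lemma ImN x : complex.Im (- x) = - complex.Im x. Proof. by case: x. Qed.
Lemma ReM x y : complex.Re (x * y) =
  complex.Re x * complex.Re y - complex.Im x * complex.Im y.
Proof. by case: x => a b; case: y. Qed.
Lemma ImM x y : complex.Im (x * y) =
  complex.Re x * complex.Im y + complex.Im x * complex.Re y.
Proof. by case: x => a b; case: y. Qed.
Lemma Reconj x : complex.Re x^*%C = complex.Re x. Proof. by case: x. Qed.
Lemma Imconj x : complex.Im x^*%C = - complex.Im x. Proof. by case: x. Qed.

Definition reimE := (ReD, ImD, ReN, ImN, ReM, ImM, Reconj, Imconj).

Lemma complexP x y :
  complex.Re x = complex.Re y -> complex.Im x = complex.Im y -> x = y.
Proof. by case: x => a b; case: y => c d /= -> ->. Qed.

Lemma sqmod_ge0 x : 0 <= sqmod x.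
Proof. by rewrite /sqmod addr_ge0// sqr_ge0. Qed.

Lemma sqmodE x : x * x^*%C = (sqmod x)%:C%C.
Proof. by apply: complexP; rewrite !reimE /sqmod /=; ring. Qed.

Lemma sqmod_norm x : `|x| ^+ 2 = (sqmod x)%:C%C.
Proof. by rewrite -add_Re2_Im2. Qed.

Lemma sqmodM x y : sqmod (x * y) = sqmod x * sqmod y.
Proof. by rewrite /sqmod !reimE; ring. Qed.

Lemma sqmodJ x : sqmod x^*%C = sqmod x.
Proof. by rewrite /sqmod !reimE; ring. Qed.

Lemma sqmod0 : sqmod (0 : C) = 0.
Proof. by rewrite /sqmod /=; ring. Qed.

Lemma sqmod1 : sqmod (1 : C) = 1.
Proof. by rewrite /sqmod /=; ring. Qed.

Lemma sqmod_eq0 x : sqmod x = 0 -> x = 0.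
Proof.
move=> /eqP; rewrite paddr_eq0 ?sqr_ge0// !sqrf_eq0 => /andP[/eqP a /eqP b].
exact: complexP.
Qed.

Lemma sqmodD_le x y : sqmod (x + y) <= 2 * sqmod x + 2 * sqmod y.
Proof.
rewrite /sqmod !reimE.
have := sqr_ge0 (complex.Re x - complex.Re y).
have := sqr_ge0 (complex.Im x - complex.Im y).
nra.
Qed.

Lemma sqmod_cis (t : R) : sqmod (cis t) = 1.
Proof. by rewrite /sqmod /= cos2Dsin2. Qed.

Lemma cis_neq0 (t : R) : cis t != 0.
Proof.
by apply/eqP => h; have := sqmod_cis t; rewrite h sqmod0 => /eqP; rewrite eq_sym oner_eq0.
Qed.

Lemma cisD (s t : R) : cis (s + t) = cis s * cis t.
Proof. by apply: complexP; rewrite !reimE /= ?cosD ?sinD; ring. Qed.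

Lemma cis0 : cis (0 : R) = 1.
Proof. by rewrite /cis cos0 sin0. Qed.

Lemma cisN (t : R) : cis (- t) = (cis t)^*%C.
Proof. by apply: complexP; rewrite !reimE /= ?cosN ?sinN. Qed.

Lemma cisV (t : R) : (cis t)^-1 = cis (- t).
Proof.
apply: (mulfI (cis_neq0 t)); rewrite mulfV ?cis_neq0//.
by rewrite -cisD subrr cis0.
Qed.

Lemma cisX (t : R) (n : nat) : cis t ^+ n = cis (t *+ n).
Proof.
elim: n => [|n IH]; first by rewrite expr0 mulr0n cis0.
by rewrite exprS IH -cisD mulrS.
Qed.

Lemma cisXz (t : R) (k : int) : cis t ^ k = cis (t *~ k).
Proof.
case: k => n; first by rewrite -exprnP cisX.
by rewrite NegzE -exprnN -exprVn cisV cisX mulrNz mulNrn.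
Qed.

Lemma sqmod_cisXz (t : R) (k : int) : sqmod (cis t ^ k) = 1.
Proof. by rewrite cisXz sqmod_cis. Qed.

Lemma conj_cisXz (t : R) (k : int) : ((cis t ^ k)^*)%C = cis t ^ (- k).
Proof. by rewrite !cisXz -cisN mulrNz. Qed.

Lemma cis2pi (t : R) : cis (2 * pi - t) = cis (- t).
Proof.
by rewrite cisD; rewrite [cis (2 * pi)](_ : _ = 1) ?mul1r// /cis mulr_natl cos2pi sin2pi.
Qed.

End ComplexParts.

Section Measurability.
Context {R : realType}.
Local Notation C := R[i].
Implicit Types (f g : C -> C).

(** No sigma-algebra is put on the complex numbers: measurability is that of the
    two real parts in the angular variable. *)
Definition mfunT f := measurable_fun setT (reT f) /\ measurable_fun setT (imT f).

Lemma mfunTD f g : mfunT f -> mfunT g -> mfunT (fun z => f z + g z).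
Proof.
move=> [f1 f2] [g1 g2]; split.
- rewrite (_ : reT _ = reT f \+ reT g); first exact: measurable_funD.
  by apply/funext => t; rewrite /reT /= !reimE.
- rewrite (_ : imT _ = imT f \+ imT g); first exact: measurable_funD.
  by apply/funext => t; rewrite /imT /= !reimE.
Qed.

Lemma mfunTM f g : mfunT f -> mfunT g -> mfunT (fun z => f z * g z).
Proof.
move=> [f1 f2] [g1 g2]; split.
- rewrite (_ : reT _ = (reT f \* reT g) \- (imT f \* imT g)).
    by apply: measurable_funB; apply: measurable_funM.
  by apply/funext => t; rewrite /reT /imT /= !reimE.
- rewrite (_ : imT _ = (reT f \* imT g) \+ (imT f \* reT g)).
    by apply: measurable_funD; apply: measurable_funM.
  by apply/funext => t; rewrite /reT /imT /= !reimE.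
Qed.

Lemma mfunT_conj f : mfunT f -> mfunT (fun z => (f z)^*%C).
Proof.
move=> [f1 f2]; split.
- by rewrite (_ : reT _ = reT f)//; apply/funext => t; rewrite /reT /= !reimE.
- rewrite (_ : imT _ = -%R \o imT f).
    by apply: measurableT_comp => //; exact: oppr_measurable.
  by apply/funext => t; rewrite /imT /= !reimE.
Qed.

Lemma mfunT_cst (c : C) : mfunT (fun=> c).
Proof. by split; exact: measurable_cst. Qed.

Lemma mfunT_expz (k : int) : mfunT (fun z => z ^ k).
Proof.
split.
- rewrite (_ : reT _ = cos \o (fun t => t *~ k)).
    apply: measurableT_comp; first exact: continuous_measurable_fun (@continuous_cos R).
    under eq_fun do rewrite -mulrzr.
    exact: measurable_funM.
  by apply/funext => t; rewrite /reT cisXz.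
- rewrite (_ : imT _ = sin \o (fun t => t *~ k)).
    apply: measurableT_comp; first exact: continuous_measurable_fun (@continuous_sin R).
    under eq_fun do rewrite -mulrzr.
    exact: measurable_funM.
  by apply/funext => t; rewrite /imT cisXz.
Qed.

Lemma mfunT_refl f : mfunT f -> mfunT (fun z => f (z^*)%C).
Proof.
move=> [f1 f2]; split.
- rewrite (_ : reT _ = reT f \o -%R).
    by apply: measurableT_comp => //; exact: oppr_measurable.
  by apply/funext => t; rewrite /reT /comp cisN.
- rewrite (_ : imT _ = imT f \o -%R).
    by apply: measurableT_comp => //; exact: oppr_measurable.
  by apply/funext => t; rewrite /imT /comp cisN.
Qed.

Lemma mfunT_sqmod f : mfunT f -> measurable_fun setT (fun t => sqmod (f (cis t))).
Proof.
by move=> [f1 f2]; apply: measurable_funD; apply: measurable_funX.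
Qed.

End Measurability.

(** * Lebesgue classes on the circle in terms of integrability *)

Section RealIntegrals.
Context d (T : measurableType d) (R : realType).
Variable mu : {measure set T -> \bar R}.
Implicit Types f g : T -> R.

Definition rintegrable f := mu.-integrable setT (EFin \o f).

Lemma rintegrable_mfun f : rintegrable f -> measurable_fun setT f.
Proof. by case/integrableP => /measurable_EFinP. Qed.

Lemma rintegrable_dom f g : measurable_fun setT f -> rintegrable g ->
  {ae mu, forall t, `|f t| <= g t} -> rintegrable f.
Proof.
move=> mf ig fg; have mg := rintegrable_mfun ig.
case/integrableP: (ig) => _ ig'; apply/integrableP; split.
  exact/measurable_EFinP.
apply: le_lt_trans ig'; apply: ae_ge0_le_integral => //=.
- by do 2 apply: measurableT_comp => //.
- by do 2 apply: measurableT_comp => //.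
- by apply: filterS fg => t ft _; rewrite lee_fin (le_trans ft)// ler_norm.
Qed.

Lemma rintegrableD f g : rintegrable f -> rintegrable g ->
  rintegrable (fun t => f t + g t).
Proof. exact: integrableD. Qed.

Lemma rintegrableZ a f : rintegrable f -> rintegrable (fun t => a * f t).
Proof. exact: integrableZl. Qed.

Lemma eq_ae_Rintegral f g : measurable_fun setT f -> measurable_fun setT g ->
  {ae mu, forall t, f t = g t} -> \int[mu]_t f t = \int[mu]_t g t.
Proof.
move=> mf mg fg; congr fine; apply: ae_eq_integral => //.
- exact/measurable_EFinP.
- exact/measurable_EFinP.
- by apply: filterS fg => t ->.
Qed.

Lemma Rintegral_eq0_ae f : rintegrable f -> (forall t, 0 <= f t) ->
  \int[mu]_t f t <= 0 -> {ae mu, forall t, f t = 0}.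
Proof.
move=> i0 f0 i1.
have e0 : (\int[mu]_t `|(EFin \o f) t| = 0)%E.
  under eq_integral do rewrite /= ger0_norm//.
  rewrite -[LHS]fineK; last exact: integrable_fin_num.
  by congr EFin; apply/eqP; rewrite eq_le i1 fine_ge0 //
    integral_ge0 // => x _; rewrite lee_fin.
have mf : measurable_fun setT (EFin \o f) by case/integrableP: i0.
have := (ae_eq_integral_abs mu measurableT mf).1 e0.
by apply: filterS => t /(_ I) /= [].
Qed.

Lemma Lfun2P f : f \in Lfun mu 2%:E <->
  measurable_fun setT f /\ rintegrable (fun t => f t ^+ 2).
Proof.
split=> [L|[mf L]].
  split; last exact: Lfun2_integrable_sqr.
  by move: L; rewrite inE => /andP[]; rewrite inE.
rewrite inE; apply/andP; split; rewrite inE//=.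
rewrite /finite_norm unlock poweR_lty//.
case/integrableP: L => _; apply: le_lt_trans.
rewrite le_eqVlt; apply/orP; left; apply/eqP/eq_integral => t _ /=.
by rewrite powR_mulrn// -normrX.
Qed.

End RealIntegrals.

Lemma Lfun_inftyP d (T : measurableType d) (R : realType)
    (P : probability T R) (h : T -> R) : h \in Lfun P +oo%E <->
  measurable_fun setT h /\ exists M : R, {ae P, forall t, `|h t| <= M}.
Proof.
have P0 : (0 < P setT)%E by rewrite probability_setT lte01.
rewrite inE; split=> [/andP[]|[mh [M hM]]].
  rewrite !inE/= => mh; rewrite /finite_norm unlock P0 => H.
  by split=> //; exact: ess_supr_bounded.
apply/andP; split; rewrite inE//= /finite_norm unlock P0.
apply: (@le_lt_trans _ _ M%:E); last exact: ltry.
by apply/ess_supP; apply: filterS hM => t /=; rewrite lee_fin.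
Qed.

(** Instance search does not find the measure structure behind the explicit
    uniform distribution. *)
#[export] Instance arc_ae_filter (R : realType) :
  Filter (nbhs (almost_everywhere (uniform_prob (two_pi_gt0 R)))).
Proof. exact: (@ae_filter_ringOfSetsType _ _ _ (uniform_prob (two_pi_gt0 R))). Qed.

Section Integrability.
Context {R : realType}.
Local Notation C := R[i].
Local Notation mu := (uniform_prob (two_pi_gt0 R)).
Implicit Types (f g : C -> C).

Definition sqmod_arc f (t : R) : R := sqmod (f (cis t)).

Lemma sqmod_arcE f t : sqmod_arc f t = reT f t ^+ 2 + imT f t ^+ 2. Proof. by []. Qed.

Lemma arc_setT : mu setT = 1%E. Proof. exact: probability_setT. Qed.

Lemma rintegrable_cst (c : R) : rintegrable mu (fun=> c).
Proof. exact: (@finite_measure_integrable_cst _ _ _ mu setT c). Qed.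

Lemma L1P f : LT 1%E f <-> rintegrable mu (reT f) /\ rintegrable mu (imT f).
Proof.
have I h := Lfun1_integrable mu h.
split=> [[a b]|[a b]]; split; [exact: (I _).1 a|exact: (I _).1 b|
  exact: (I _).2 a|exact: (I _).2 b].
Qed.

Lemma L1_mfun f : LT 1%E f -> mfunT f.
Proof. by move/L1P => [a b]; split; [exact: rintegrable_mfun a|
  exact: rintegrable_mfun b]. Qed.

Lemma L1_dom f (g : R -> R) : mfunT f -> rintegrable mu g ->
  {ae mu, forall t, `|reT f t| <= g t /\ `|imT f t| <= g t} -> LT 1%E f.
Proof.
move=> [m1 m2] ig fg; apply/L1P; split; apply: (rintegrable_dom _ ig) => //;
  by apply: filterS fg => t [].
Qed.

Lemma L2P f : LT 2%:E f <-> mfunT f /\ rintegrable mu (sqmod_arc f).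
Proof.
split=> [[/Lfun2P[m1 i1] /Lfun2P[m2 i2]]|[[m1 m2] i]].
  by split=> //; exact: rintegrableD.
split; apply/Lfun2P; split=> //; apply: (rintegrable_dom _ i).
- exact: measurable_funX.
- by apply: aeW => t; rewrite ger0_norm ?sqr_ge0// sqmod_arcE lerDl sqr_ge0.
- exact: measurable_funX.
- by apply: aeW => t; rewrite ger0_norm ?sqr_ge0// sqmod_arcE lerDr sqr_ge0.
Qed.

Lemma L2_mfun f : LT 2%:E f -> mfunT f. Proof. by case/L2P. Qed.

Lemma LooP f : LT +oo%E f <->
  mfunT f /\ exists M : R, {ae mu, forall t, sqmod_arc f t <= M}.
Proof.
split=> [[/Lfun_inftyP[m1 [M1 h1]] /Lfun_inftyP[m2 [M2 h2]]]|[[m1 m2] [M h]]].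
  split=> //; exists (M1 ^+ 2 + M2 ^+ 2); apply: filterS2 h1 h2 => t h1 h2.
  rewrite sqmod_arcE lerD// -real_normK ?num_real// ler_sqr ?nnegrE//.
    exact: le_trans h1.
  exact: le_trans h2.
split; apply/Lfun_inftyP; split=> //; exists (M + 1); apply: filterS h => t;
  rewrite sqmod_arcE => h.
- have := sqr_ge0 (imT f t); have : 0 <= `|reT f t| by [].
  have : `|reT f t| ^+ 2 = reT f t ^+ 2 by rewrite real_normK ?num_real.
  nra.
- have := sqr_ge0 (reT f t); have : 0 <= `|imT f t| by [].
  have : `|imT f t| ^+ 2 = imT f t ^+ 2 by rewrite real_normK ?num_real.
  nra.
Qed.

Lemma Loo_mfun f : LT +oo%E f -> mfunT f. Proof. by case/LooP. Qed.

Lemma Loo_cst (c : C) : LT +oo%E (fun=> c).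
Proof.
apply/LooP; split; first exact: mfunT_cst.
by exists (sqmod c); apply: aeW => t; rewrite /sqmod_arc.
Qed.

Lemma LooD f g : LT +oo%E f -> LT +oo%E g -> LT +oo%E (fun z => f z + g z).
Proof.
move=> /LooP[m1 [M1 h1]] /LooP[m2 [M2 h2]]; apply/LooP; split; first exact: mfunTD.
exists (2 * M1 + 2 * M2); apply: filterS2 h1 h2 => t h1 h2.
rewrite /sqmod_arc (le_trans (sqmodD_le _ _))//; rewrite /sqmod_arc in h1 h2; lra.
Qed.

Lemma LooM f g : LT +oo%E f -> LT +oo%E g -> LT +oo%E (fun z => f z * g z).
Proof.
move=> /LooP[m1 [M1 h1]] /LooP[m2 [M2 h2]]; apply/LooP; split; first exact: mfunTM.
exists (M1 * M2); apply: filterS2 h1 h2 => t h1 h2.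
by rewrite /sqmod_arc sqmodM ler_pM// sqmod_ge0.
Qed.

Lemma Loo_expz (k : int) : LT +oo%E (fun z : C => z ^ k).
Proof.
apply/LooP; split; first exact: mfunT_expz.
by exists 1; apply: aeW => t; rewrite /sqmod_arc sqmod_cisXz.
Qed.

Lemma Loo_L2 f : LT +oo%E f -> LT 2%:E f.
Proof.
move=> /LooP[m [M h]]; apply/L2P; split=> //.
apply: (rintegrable_dom _ (rintegrable_cst M)); first exact: mfunT_sqmod.
by apply: filterS h => t; rewrite ger0_norm// sqmod_ge0.
Qed.

Lemma L2D f g : LT 2%:E f -> LT 2%:E g -> LT 2%:E (fun z => f z + g z).
Proof.
move=> /L2P[m1 i1] /L2P[m2 i2]; apply/L2P; split; first exact: mfunTD.
apply: (rintegrable_dom _ (rintegrableD (rintegrableZ 2 i1) (rintegrableZ 2 i2))); first by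
  apply: mfunT_sqmod; exact: mfunTD.
by apply: aeW => t; rewrite ger0_norm ?sqmod_ge0// sqmodD_le.
Qed.

Lemma LooM_L2 f g : LT +oo%E f -> LT 2%:E g -> LT 2%:E (fun z => f z * g z).
Proof.
move=> /LooP[m1 [M h]] /L2P[m2 i2]; apply/L2P; split; first exact: mfunTM.
apply: (rintegrable_dom _ (rintegrableZ M i2)); first by
  apply: mfunT_sqmod; exact: mfunTM.
apply: filterS h => t h; rewrite ger0_norm ?sqmod_ge0// /sqmod_arc sqmodM.
by rewrite ler_wpM2r// sqmod_ge0.
Qed.

Lemma L2Z (c : C) f : LT 2%:E f -> LT 2%:E (fun z => c * f z).
Proof. exact: LooM_L2 (Loo_cst c). Qed.

Lemma L2N f : LT 2%:E f -> LT 2%:E (fun z => - f z).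
Proof.
by move=> /(L2Z (-1)); under eq_fun do rewrite mulN1r.
Qed.

Lemma L2B f g : LT 2%:E f -> LT 2%:E g -> LT 2%:E (fun z => f z - g z).
Proof. by move=> lf lg; apply: L2D => //; exact: L2N. Qed.

Lemma L2_conj f : LT 2%:E f -> LT 2%:E (fun z => (f z)^*%C).
Proof.
move=> /L2P[m i]; apply/L2P; split; first exact: mfunT_conj.
rewrite (_ : sqmod_arc _ = sqmod_arc f)//; apply/funext => t; exact: sqmodJ.
Qed.

Lemma L2_cst (c : C) : LT 2%:E (fun=> c).
Proof. by apply: Loo_L2; exact: Loo_cst. Qed.

Lemma L2_expz (k : int) : LT 2%:E (fun z : C => z ^ k).
Proof. by apply: Loo_L2; exact: Loo_expz. Qed.

Lemma L2_sum (I : Type) (s : seq I) (P : pred I) (F : I -> C -> C) :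
  (forall i, P i -> LT 2%:E (F i)) -> LT 2%:E (fun z => \sum_(i <- s | P i) F i z).
Proof.
move=> h; elim: s => [|i s IH].
  by under eq_fun do rewrite big_nil; exact: L2_cst.
under eq_fun do rewrite big_cons.
by case: (boolP (P i)) => Pi //; apply: L2D => //; exact: h.
Qed.

Lemma L2M f g : LT 2%:E f -> LT 2%:E g -> LT 1%E (fun z => f z * g z).
Proof.
move=> /L2P[m1 i1] /L2P[m2 i2].
apply: (L1_dom (mfunTM m1 m2) (rintegrableD i1 i2)); apply: aeW => t.
rewrite !sqmod_arcE /reT /imT !reimE !ler_norml.
move: (complex.Re _) (complex.Im _) (complex.Re _) (complex.Im _) => a b c d.
have := sqr_ge0 (a - c); have := sqr_ge0 (b - d); have := sqr_ge0 (a - d).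
have := sqr_ge0 (b - c); have := sqr_ge0 (a + c); have := sqr_ge0 (b + d).
have := sqr_ge0 (a + d); have := sqr_ge0 (b + c); rewrite !expr2.
by move=> *; split; apply/andP; split; lra.
Qed.

Lemma L2_L1 f : LT 2%:E f -> LT 1%E f.
Proof.
by move=> /L2M /(_ (L2_cst 1)); under eq_fun do rewrite mulr1.
Qed.

Lemma L1D f g : LT 1%E f -> LT 1%E g -> LT 1%E (fun z => f z + g z).
Proof.
move=> /L1P[a b] /L1P[c d]; apply/L1P; split.
- by rewrite (_ : reT _ = (fun t => reT f t + reT g t)); [exact: rintegrableD|
    apply/funext => t; rewrite /reT reimE].
- by rewrite (_ : imT _ = (fun t => imT f t + imT g t)); [exact: rintegrableD|
    apply/funext => t; rewrite /imT reimE].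
Qed.

Lemma LooM_L1 f g : LT +oo%E f -> LT 1%E g -> LT 1%E (fun z => f z * g z).
Proof.
move=> /[dup] /Loo_mfun m1 [/Lfun_inftyP[_ [M1 h1]] /Lfun_inftyP[_ [M2 h2]]].
move=> /[dup] /L1_mfun m2 /L1P[i1 i2].
pose M : R := `|M1| + `|M2|.
have j (h : R -> R) : rintegrable mu h -> rintegrable mu (fun t => `|h t|)
  by exact: integrable_norm.
apply: (L1_dom (mfunTM m1 m2) (rintegrableZ M (rintegrableD (j _ i1) (j _ i2)))).
apply: filterS2 h1 h2 => t; rewrite /reT /imT !reimE /M /=.
move: (complex.Re _) (complex.Im _) (complex.Re _) (complex.Im _) => c d a b h1 h2.
have {h1} h1 : `|a| <= `|M1| by rewrite (le_trans h1)// ler_norm.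
have {h2} h2 : `|b| <= `|M2| by rewrite (le_trans h2)// ler_norm.
have h3 := ler_normB (a * c) (b * d); have h4 := ler_normD (a * d) (b * c).
rewrite !normrM in h3 h4.

have pM (x y z : R) : `|x| <= `|y| -> `|x| * `|z| <= `|y| * `|z|.
  by move=> xy; rewrite ler_wpM2r.
have q1 := pM _ _ c h1; have q2 := pM _ _ d h2; have q3 := pM _ _ d h1.
have q4 := pM _ _ c h2.
have r (x y : R) : 0 <= `|x| * `|y| by rewrite mulr_ge0.
have := r M1 c; have := r M1 d; have := r M2 c; have := r M2 d.
by split; lra.
Qed.

Lemma L1Z (c : C) f : LT 1%E f -> LT 1%E (fun z => c * f z).
Proof. exact: LooM_L1 (Loo_cst c). Qed.

Lemma L1N f : LT 1%E f -> LT 1%E (fun z => - f z).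
Proof. by move=> /(L1Z (-1)); under eq_fun do rewrite mulN1r. Qed.

Lemma L1B f g : LT 1%E f -> LT 1%E g -> LT 1%E (fun z => f z - g z).
Proof. by move=> lf lg; apply: L1D => //; exact: L1N. Qed.

Lemma intTD f g : LT 1%E f -> LT 1%E g ->
  intT (fun z => f z + g z) = intT f + intT g.
Proof.
move=> /L1P[a b] /L1P[c d]; apply: complexP; rewrite reimE /=.
- by rewrite -RintegralD//; apply: eq_Rintegral => t _; rewrite /reT reimE.
- by rewrite -RintegralD//; apply: eq_Rintegral => t _; rewrite /imT reimE.
Qed.

Lemma intTZ (c : C) f : LT 1%E f -> intT (fun z => c * f z) = c * intT f.
Proof.
move=> /L1P[a b]; apply: complexP; rewrite reimE /= -!RintegralZl//.
- rewrite -RintegralB//; [|exact: rintegrableZ|exact: rintegrableZ].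
  by apply: eq_Rintegral => t _; rewrite /reT reimE.
- rewrite -RintegralD//; [|exact: rintegrableZ|exact: rintegrableZ].
  by apply: eq_Rintegral => t _; rewrite /imT reimE.
Qed.

Lemma intTB f g : LT 1%E f -> LT 1%E g ->
  intT (fun z => f z - g z) = intT f - intT g.
Proof.
move=> lf lg; rewrite intTD//; last exact: L1N.
rewrite -[- intT g]mulN1r -intTZ//; congr (_ + intT _).
by apply/funext => z; rewrite mulN1r.
Qed.

Lemma intT_cst (c : C) : intT (fun=> c) = c.
Proof.
have I (r : R) : \int[mu]_t (fun=> r) t = r.
  rewrite /= Rintegral_cst// -[RHS]mulr1; congr (_ * _).
  exact: (congr1 fine arc_setT).
by apply: complexP; exact: I.
Qed.

Lemma intT_conj f : LT 1%E f -> intT (fun z => (f z)^*%C) = (intT f)^*%C.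
Proof.
move=> /L1P[a b]; apply: complexP; rewrite reimE /=.
  by apply: eq_Rintegral => t _; rewrite /reT reimE.
rewrite -mulN1r -RintegralZl//.
by apply: eq_Rintegral => t _; rewrite /imT reimE mulN1r.
Qed.

Lemma intT_sum (I : Type) (s : seq I) (P : pred I) (F : I -> C -> C) :
  (forall i, P i -> LT 1%E (F i)) ->
  LT 1%E (fun z => \sum_(i <- s | P i) F i z) /\
  intT (fun z => \sum_(i <- s | P i) F i z) = \sum_(i <- s | P i) intT (F i).
Proof.
move=> h; elim: s => [|i s [IH1 IH2]].
  rewrite big_nil; under eq_fun do rewrite big_nil; split.
    by apply: L2_L1; exact: L2_cst.
  by rewrite intT_cst.
rewrite big_cons; under eq_fun do rewrite big_cons.
case: (boolP (P i)) => Pi //; split; first by apply: L1D => //; exact: h.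
by rewrite intTD ?IH2//; exact: h.
Qed.

Lemma eq_intT f g : mfunT f -> mfunT g -> eqT f g -> intT f = intT g.
Proof.
rewrite /eqT /aeT => -[m1 m2] [m3 m4] fg; apply: complexP.
- rewrite /=; apply: (@eq_ae_Rintegral _ _ _ mu _ _ m1 m3).
  by apply: filterS fg => t /= e; rewrite /reT /imT e.
- rewrite /=; apply: (@eq_ae_Rintegral _ _ _ mu _ _ m2 m4).
  by apply: filterS fg => t /= e; rewrite /reT /imT e.
Qed.

End Integrability.

(** * A function with vanishing Fourier coefficients is null *)

Section StepApproximation.
Context {R : realType}.
Implicit Types (x w : R) (n : nat).

Lemma bernoulli_lower x n : 0 <= x <= 1 -> 1 - x *+ n <= (1 - x) ^+ n.
Proof.
move=> /andP[x0 x1]; elim: n => [|n IH]; first by rewrite mulr0n subr0 expr0.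
have y : 0 <= x *+ n by rewrite mulrn_wge0.
by rewrite exprS mulrS; nra.
Qed.

Lemma bernoulli_upper x n : 0 <= x <= 1 -> (1 - x) ^+ n * (1 + x *+ n) <= 1.
Proof.
move=> /andP[x0 x1]; elim: n => [|n IH].
  by rewrite mulr0n addr0 mulr1 expr0.
have y : 0 <= x *+ n by rewrite mulrn_wge0.
apply: le_trans IH; rewrite exprS mulrS mulrAC mulrC.
rewrite ler_wpM2l ?exprn_ge0 ?subr_ge0//; nra.
Qed.

(** The polynomials below are those of the Brosowski-Deutsch proof of the
    Stone-Weierstrass theorem: by Bernoulli's inequality they stay within the
    unit interval and tend to the indicator function of w < 1/2. *)
Definition step_poly w n : R := (1 - w ^+ n) ^+ (2 ^ n).

Lemma step_poly_itv w n : 0 <= w <= 1 -> 0 <= step_poly w n <= 1.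
Proof.
move=> /andP[w0 w1].
have a : 0 <= w ^+ n by rewrite exprn_ge0.
have b : w ^+ n <= 1 by rewrite exprn_ile1.
by rewrite exprn_ge0 ?subr_ge0//= exprn_ile1 ?subr_ge0 // gerBl.
Qed.

Lemma expr2M w n : w ^+ n *+ (2 ^ n) = (2 * w) ^+ n.
Proof. by rewrite exprMn -mulr_natl natrX. Qed.

Lemma step_poly_lt w : 0 <= w < 1/2 -> step_poly w n @[n --> \oo] --> (1 : R).
Proof.
move=> /andP[w0 w2]; have w1 : w <= 1 by lra.
apply: (@squeeze_cvgr _ _ _ _ (fun n => 1 - (2 * w) ^+ n) (fun=> 1)).
- have i : 0 <= w <= 1 by rewrite w0 w1.
  apply: nearW => n; have /andP[_ ->] := step_poly_itv n i.
  by rewrite andbT -expr2M bernoulli_lower// exprn_ge0//= exprn_ile1.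
- rewrite -[X in _ --> X]subr0; apply: cvgB; first exact: cvg_cst.
  by apply: cvg_expr; rewrite ger0_norm; lra.
- exact: cvg_cst.
Qed.

Lemma step_poly_gt w : 1/2 < w <= 1 -> step_poly w n @[n --> \oo] --> (0 : R).
Proof.
move=> /andP[w2 w1]; have w0 : 0 <= w by lra.
have v0 : 0 < 2 * w by lra.
apply: (@squeeze_cvgr _ _ _ _ (fun=> 0) (fun n => (2 * w)^-1 ^+ n)).
- have i : 0 <= w <= 1 by rewrite w0 w1.
  apply: nearW => n; have /andP[q0 _] := step_poly_itv n i.
  rewrite q0//= exprVn -[leRHS]mul1r ler_pdivlMr ?exprn_gt0//.
  have := @bernoulli_upper (w ^+ n) (2 ^ n).
  rewrite exprn_ge0//= exprn_ile1// => /(_ isT); apply: le_trans.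
  by rewrite ler_wpM2l ?q0// expr2M lerDr.
- exact: cvg_cst.
- apply: cvg_expr; rewrite ger0_norm ?invr_ge0 ?ltW// invf_lt1//; lra.
Qed.

End StepApproximation.

Section ArcIndicators.
Context {R : realType}.
Implicit Types (a c t delta : R).

(** An affine function of cos (t - a), hence a trigonometric polynomial, which is
    below 1/2 exactly on the arc cos (t - a) > c; dividing by 4 keeps its values
    within the unit interval. *)
Definition ramp a c t : R := 1/2 + (c - cos (t - a)) / 4.

Lemma ramp_itv a c t : -1 <= c <= 1 -> 0 <= ramp a c t <= 1.
Proof.
move=> /andP[c1 c2]; have := cos_le1 (t - a); have := cos_geN1 (t - a).
by rewrite /ramp => *; apply/andP; split; lra.
Qed.

Lemma cos_2piB t : cos (2 * pi - t) = cos t.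
Proof. by have /(congr1 (@complex.Re R)) := cis2pi t; rewrite /= cosN. Qed.

Lemma cos_arc_in a delta t : 0 < delta < pi -> `|t - a| < delta ->
  cos delta < cos (t - a).
Proof.
move=> /andP[d0 d1] h; rewrite -(cos_norm (t - a)).
by rewrite ltr_cos ?in_itv/= ?normr_ge0 ?(ltW d0) ?(ltW d1) //= (ltW (lt_trans h _)).
Qed.

Lemma cos_arc_out a delta t : 0 < delta -> 0 < a - delta -> a + delta < 2 * pi ->
  0 <= t <= 2 * pi -> delta < `|t - a| -> cos (t - a) < cos delta.
Proof.
move=> d0 ad1 ad2 /andP[t0 t1] h; rewrite -(cos_norm (t - a)).
have d1 : delta < pi by lra.
have s1 : `|t - a| < 2 * pi - delta by rewrite ltr_norml; apply/andP; split; lra.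
have [sp|sp] := leP `|t - a| pi.
  by rewrite ltr_cos ?in_itv/= ?normr_ge0 ?(ltW d0) ?(ltW d1).
rewrite -cos_2piB ltr_cos ?in_itv/= ?(ltW d0) ?(ltW d1)//; first by lra.
by apply/andP; split; lra.
Qed.

End ArcIndicators.

#[export] Instance lebesgue_ae_filter (R : realType) :
  Filter (nbhs (almost_everywhere (@lebesgue_measure R))).
Proof. exact: (@ae_filter_ringOfSetsType _ _ _ (@lebesgue_measure R)). Qed.

Section ArcLebesgue.
Context {R : realType}.
Local Notation mu := (uniform_prob (two_pi_gt0 R)).
Local Notation lam := (@lebesgue_measure R).
Local Notation D := (`[0, 2 * pi]%classic : set R).
Implicit Types (g h : R -> R).

Lemma arc_ge0_integral (f : R -> \bar R) : measurable_fun setT f ->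
  (forall x, 0 <= f x)%E ->
  (\int[mu]_x f x = ((2 * pi)^-1)%:E * \int[lam]_(x in D) f x)%E.
Proof. by move=> mf f0; rewrite integral_uniform// subr0. Qed.

Lemma ge0_lty_arc (f : R -> \bar R) : measurable_fun setT f ->
  (forall x, 0 <= f x)%E -> (\int[mu]_x f x < +oo)%E ->
  (\int[lam]_(x in D) f x < +oo)%E.
Proof.
move=> mf f0; rewrite arc_ge0_integral//.
have : (0 <= \int[lam]_(x in D) f x)%E by exact: integral_ge0.
case: (\int[lam]_(x in D) f x)%E => [r _ _||//]; first exact: ltry.
by rewrite mulry gtr0_sg ?invr_gt0 ?two_pi_gt0// mul1e ltxx.
Qed.

Lemma arc_integrable g : rintegrable mu g -> lam.-integrable D (EFin \o g).
Proof.
move=> /integrableP[mg ig]; apply/integrableP; split; first exact: measurable_funTS.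
by apply: ge0_lty_arc => //; exact: measurableT_comp.
Qed.

Lemma arc_integral g : rintegrable mu g ->
  (\int[mu]_x (g x)%:E = ((2 * pi)^-1)%:E * \int[lam]_(x in D) (g x)%:E)%E.
Proof.
move=> ig; have iD := arc_integrable ig; case/integrableP: (ig) => mg _.
have e1 := arc_ge0_integral (measurable_funepos mg) (fun=> funepos_ge0 _ _).
have e2 := arc_ge0_integral (measurable_funeneg mg) (fun=> funeneg_ge0 _ _).
have e3 := integralE lam D (EFin \o g).
have e4 := @integrable_add_def _ _ _ lam D (measurable_itv _) _ iD.
rewrite [LHS]integralE e1 e2 [X in _ = (_ * X)%E]e3.
move: e4; move: (integral lam D (EFin \o g)^\+%E) (integral lam D (EFin \o g)^\-%E).
by move=> A B e4; rewrite muleBr.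
Qed.

Lemma ae_arc (P : R -> Prop) : {ae lam, forall t, 0 <= t <= 2 * pi -> P t} ->
  {ae mu, forall t, P t}.
Proof.
move=> [N [mN N0 NP]].
have mC : measurable (~` D) by exact: measurableC.
have muN : mu N = 0%E.
  have /null_content_dominatesP dom := dominates_uniform_prob (two_pi_gt0 R).
  exact: dom.
have muD : mu (~` D) = 0%E.
  by rewrite [LHS]integral_uniform_pdf setICl integral_set0.
exists (N `|` ~` D); split.
- exact: measurableU.
- exact: etrans (measureU0 mN mC muD) muN.
- move=> t /= nP; have [tD|tD] := boolP (0 <= t <= 2 * pi).
    by left; apply: NP => /= /(_ tD).
  by right; rewrite /= in_itv/=; exact/negP.
Qed.

Lemma ae_neq_lebesgue (a : R) : {ae lam, forall t, t != a}.
Proof.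
exists [set a]; split=> //; first exact: lebesgue_measure_set1.
by move=> t /= /negP; rewrite negbK => /eqP.
Qed.

End ArcLebesgue.

Section Vanishing.
Context {R : realType}.
Local Notation mu := (uniform_prob (two_pi_gt0 R)).
Local Notation lam := (@lebesgue_measure R).
Local Notation D := (`[0, 2 * pi]%classic : set R).
Variable h : R -> R.
Hypothesis ih : rintegrable mu h.
Hypothesis hstep : forall n (a c : R), -1 <= c <= 1 ->
  \int[mu]_t (h t * step_poly (ramp a c t) n) = 0.

Let mramp (a c : R) n : measurable_fun setT (fun t => step_poly (ramp a c t) n).
Proof.
apply: measurable_funX; apply: measurable_funB => //; apply: measurable_funX.
apply: measurable_funD => //; apply: measurable_funM => //.
apply: measurable_funB => //; apply: measurableT_comp.
  exact: continuous_measurable_fun (@continuous_cos R).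
exact: measurable_funB.
Qed.

Let hstep_dom a c n t : -1 <= c <= 1 -> `|h t * step_poly (ramp a c t) n| <= `|h t|.
Proof.
move=> c1; have /andP[q0 q1] := step_poly_itv n (ramp_itv a t c1).
by rewrite normrM (ger0_norm q0) ler_piMr.
Qed.

Let hstep_intg a c n : -1 <= c <= 1 ->
  rintegrable mu (fun t => h t * step_poly (ramp a c t) n).
Proof.
move=> c1; have mh := rintegrable_mfun ih.
have ia : rintegrable mu (fun t => `|h t|) by exact: integrable_norm.
apply: (rintegrable_dom _ ia); first by apply: measurable_funM => //; exact: mramp.
by apply: aeW => t; exact: hstep_dom.
Qed.

(** On an arc with centre a and half-width delta, the polynomials step_poly in the
    ramp with threshold cos delta converge boundedly to the indicator function
    away from the two endpoints: dominated convergence applies. *)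
Lemma vanishing_arc (a delta : R) : 0 < delta -> 0 < a - delta ->
  a + delta < 2 * pi -> (\int[lam]_(x in `](a - delta)%R, (a + delta)%R[) (h x)%:E = 0)%E.
Proof.
move=> d0 ad1 ad2; have dpi : delta < pi by lra.
pose c := cos delta; have c1 : -1 <= c <= 1 by rewrite cos_geN1 cos_le1.
pose B : set R := `]a - delta, a + delta[%classic.
pose f_ n := EFin \o (fun t => h t * step_poly (ramp a c t) n).
pose f := EFin \o (fun t => h t * \1_B t).
have mh := rintegrable_mfun ih.
have mB : measurable B by exact: measurable_itv.
have [] := @dominated_convergence _ _ _ lam D (measurable_itv _) f_ f
  (fun t => `|h t|%:E).
- move=> n; apply: measurable_funTS; apply/measurable_EFinP.
  by apply: measurable_funM => //; exact: mramp.
- apply: measurable_funTS; apply/measurable_EFinP.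
  by apply: measurable_funM => //; exact: measurable_indic.
- apply: filterS2 (ae_neq_lebesgue (a - delta)) (ae_neq_lebesgue (a + delta)).
  move=> t n1 n2; rewrite /= in_itv /= => tD.
  apply/cvg_EFin; first by apply: nearW.
  rewrite /f /f_ /=.
  apply: cvgM; first exact: cvg_cst.
  rewrite indicE; have [tB|tB] := boolP (t \in B).
    apply: step_poly_lt; have := ramp_itv a t c1 => /andP[-> _] /=.
    have : `|t - a| < delta.
      by move: tB; rewrite inE /B /= in_itv/= ltr_norml => /andP[p q];
        apply/andP; split; lra.
    have dd : 0 < delta < pi by rewrite d0.
    by move=> /(cos_arc_in dd); rewrite /ramp -/c => ?; lra.
  apply: step_poly_gt; have := ramp_itv a t c1 => /andP[_ ->] /=; rewrite andbT.
  have : delta < `|t - a|.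
    rewrite ltNge; apply: contra tB; rewrite ler_norml => /andP[p q].
    rewrite inE /B /= in_itv/= !lt_neqAle; move: n1 n2; rewrite eq_sym => -> -> /=.
    by apply/andP; split; lra.
  by move=> /(cos_arc_out d0 ad1 ad2 tD); rewrite /ramp -/c => ?; lra.
- by apply: integrable_norm; exact: arc_integrable.
- by apply: aeW => t n _; rewrite /f_ /= lee_fin; exact: hstep_dom.
move=> _ _ cv.
have z n : (\int[lam]_(x in D) f_ n x = 0)%E.
  have := arc_integral (hstep_intg a n c1); have := hstep n a c1.
  rewrite /Rintegral => e.
  have fi := integrable_fin_num measurableT (hstep_intg a n c1).
  rewrite -[X in X = _ -> _](fineK fi) e.
  move=> /esym /eqP; rewrite mule_eq0 => /orP[|/eqP//].
  by rewrite eqe invr_eq0 gt_eqF// two_pi_gt0.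
have : (\int[lam]_(x in D) f x = 0)%E.
  apply: (cvg_unique _ cv) => //.
  rewrite (_ : [sequence _]_n = fun=> 0%E); first exact: cvg_cst.
  by apply/funext => n; exact: z.
move=> e; rewrite -[RHS]e.
rewrite -[LHS]/(\int[lam]_(x in B) (h x)%:E)%E.
have -> : B = D `&` B.
  apply/esym/setIidr => t; rewrite /B /= !in_itv/= => /andP[p q].
  by apply/andP; split; lra.
rewrite integral_mkcondr; apply: eq_integral => t _.
rewrite patchE /f /= indicE; case: (t \in B); by rewrite ?mulr1 ?mulr0.
Qed.

(** By vanishing_arc a primitive of h is constant, while by Lebesgue's
    differentiation theorem its derivative is h almost everywhere. *)
Lemma vanishing_ae : {ae mu, forall t, h t = 0}.
Proof.
have iD : lam.-integrable D (EFin \o h) := arc_integrable ih.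
pose hD := h \_ D.
have ihD : lam.-integrable setT (EFin \o hD).
  rewrite /hD -restrict_EFin; apply/(integrable_mkcond _ _).1 => //.
have /lebesgue_differentiation : locally_integrable setT hD.
  by apply: open_integrable_locally => //; exact: openT.
move=> lp; apply: ae_arc.
apply: filterS3 lp (ae_neq_lebesgue 0) (ae_neq_lebesgue (2 * pi)).
move=> x lx x0 x1 /andP[x2 x3].
have {x0 x2} x0 : 0 < x by rewrite lt_neqAle eq_sym x0.
have {x1 x3} x1 : x < 2 * pi by rewrite lt_neqAle x1.
pose F y := \int[lam]_(t in `[0, y]) hD t.
have [|||_ dF] := @FTC1_lebesgue_pt R hD (BLeft 0) x (2 * pi) x1.
- exact: integrableS ihD.
- by rewrite /= lte_fin.
- exact: lx.
rewrite -/F in dF.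
have hDx : hD x = h x.
  by rewrite /hD patchE mem_set//= in_itv/= ltW//= ltW.
rewrite -hDx -dF.
pose e := Num.min x (2 * pi - x) / 2.
have e0 : 0 < e by rewrite divr_gt0// lt_min x0 subr_gt0.
have e1 : e < x by rewrite /e; have := ge_min x x (2 * pi - x); rewrite lexx /=; lra.
have e2 : e < 2 * pi - x.
  by rewrite /e; have := ge_min (2 * pi - x) x (2 * pi - x); rewrite lexx orbT; lra.
have Fc y z : 0 < y -> y < z -> z < 2 * pi -> F y = F z.
  move=> y0 yz z1; apply/esym/eqP; rewrite -subr_eq0.
  rewrite /F Rintegral_itvB ?bnd_simp ?ltW//; last exact: integrableS ihD.
  have := @vanishing_arc ((y + z) / 2) ((z - y) / 2).
  rewrite (_ : (y + z) / 2 - (z - y) / 2 = y); last by field.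
  rewrite (_ : (y + z) / 2 + (z - y) / 2 = z); last by field.
  move=> v; apply/eqP; rewrite -[RHS]/(fine 0%E) -v //; last by lra.
  rewrite -Rintegral_itv_bndo_bndc; last exact: integrableS ihD.
  congr fine; apply: eq_integral => t; rewrite inE /= in_itv /= => /andP[p q].
  rewrite /hD patchE mem_set//= in_itv/=; apply/andP; split; lra.
have Fn : {near x, F =1 cst (F x)}.
  near=> y.
  have : `|x - y| < e by near: y; exact: (nbhsx_ballx x e e0).
  rewrite ltr_norml => /andP[p q].
  have [yx|xy|-> //] := ltgtP y x.
  - by rewrite /= (Fc y x)//; lra.
  - by rewrite /= -(Fc x y)//; lra.
rewrite derive1E (near_eq_derive _ Fn).
exact: derive_cst.
Unshelve. all: by end_near. Qed.

End Vanishing.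

Section FourierCoefficients.
Context {R : realType}.
Local Notation C := R[i].
Local Notation mu := (uniform_prob (two_pi_gt0 R)).
Implicit Types (f g p : C -> C).

Lemma conjcM (x y : C) : ((x * y : C)^*)%C = (x^*)%C * (y^*)%C.
Proof. exact: rmorphM. Qed.

Lemma eq_reT f g : (forall t, f (cis t) = g (cis t)) -> reT f = reT g.
Proof. by move=> fg; apply/funext => t; rewrite /reT fg. Qed.

Lemma eq_imT f g : (forall t, f (cis t) = g (cis t)) -> imT f = imT g.
Proof. by move=> fg; apply/funext => t; rewrite /imT fg. Qed.

Lemma eq_circle_intT f g : (forall t, f (cis t) = g (cis t)) -> intT f = intT g.
Proof. by move=> fg; rewrite /intT (eq_reT fg) (eq_imT fg). Qed.

Lemma eq_circle_LT q f g : (forall t, f (cis t) = g (cis t)) -> LT q f -> LT q g.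
Proof. by move=> fg; rewrite /LT /= (eq_reT fg) (eq_imT fg). Qed.

Lemma fourierE f k : fourier f k = intT (fun z => f z * z ^ (- k)).
Proof. by apply: eq_circle_intT => t; rewrite conj_cisXz. Qed.

Lemma eq_circle_fourier f g k : (forall t, f (cis t) = g (cis t)) ->
  fourier f k = fourier g k.
Proof. by move=> fg; apply: eq_circle_intT => t; rewrite fg. Qed.

Lemma L1M_expz f (m : int) : LT 1%E f -> LT 1%E (fun z => f z * z ^ m).
Proof.
move=> lf; have := LooM_L1 (Loo_expz (R:=R) m) lf.
by apply: eq_circle_LT => t; rewrite mulrC.
Qed.

Lemma L2M_expz f (m : int) : LT 2%:E f -> LT 2%:E (fun z => f z * z ^ m).
Proof.
move=> lf; have := LooM_L2 (Loo_expz (R:=R) m) lf.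
by apply: eq_circle_LT => t; rewrite mulrC.
Qed.

Lemma fourierM_expz f (m k : int) :
  fourier (fun z => f z * z ^ m) k = fourier f (k - m).
Proof.
rewrite !fourierE; apply: eq_circle_intT => t.
by rewrite -mulrA -expfzDr ?cis_neq0// opprB.
Qed.

Lemma fourierD f g k : LT 1%E f -> LT 1%E g ->
  fourier (fun z => f z + g z) k = fourier f k + fourier g k.
Proof.
move=> lf lg; rewrite !fourierE -intTD; [|exact: L1M_expz|exact: L1M_expz].
by apply: eq_circle_intT => t; rewrite mulrDl.
Qed.

Lemma fourierZ (c : C) f k : LT 1%E f ->
  fourier (fun z => c * f z) k = c * fourier f k.
Proof.
move=> lf; rewrite !fourierE -intTZ; last exact: L1M_expz.
by apply: eq_circle_intT => t; rewrite mulrA.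
Qed.

Lemma fourierB f g k : LT 1%E f -> LT 1%E g ->
  fourier (fun z => f z - g z) k = fourier f k - fourier g k.
Proof.
move=> lf lg; rewrite !fourierE -intTB; [|exact: L1M_expz|exact: L1M_expz].
by apply: eq_circle_intT => t; rewrite mulrBl.
Qed.

Lemma fourier_sum (I : Type) (s : seq I) (F : I -> C -> C) k :
  (forall i, LT 1%E (F i)) ->
  fourier (fun z => \sum_(i <- s) F i z) k = \sum_(i <- s) fourier (F i) k.
Proof.
move=> h; rewrite /fourier; under eq_fun do rewrite mulr_suml.
have [|_ ->//] := @intT_sum R I s xpredT (fun i z => F i z * ((z ^ k)^*)%C).
move=> i _; have := L1M_expz (- k) (h i).
by apply: eq_circle_LT => t; rewrite conj_cisXz.
Qed.

Lemma fourierJ f k : LT 1%E f -> fourier (fun z => (f z)^*%C) k = (fourier f (- k))^*%C.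
Proof.
move=> lf; rewrite !fourierE opprK -intT_conj; last exact: L1M_expz.
apply: eq_circle_intT => t; rewrite -conj_cisXz; exact: esym (conjcM _ _).
Qed.

Lemma eq_fourier f g k : mfunT f -> mfunT g -> eqT f g -> fourier f k = fourier g k.
Proof.
move=> mf mg fg; rewrite !fourierE; apply: eq_intT.
- by apply: mfunTM => //; exact: mfunT_expz.
- by apply: mfunTM => //; exact: mfunT_expz.
- by move: fg; rewrite /eqT /aeT; apply: filterS => t /= ->.
Qed.

Section Uniqueness.
Variable f : C -> C.
Hypothesis lf : LT 1%E f.
Hypothesis f0 : forall k, fourier f k = 0.

(* The bounded multipliers p for which every Fourier coefficient of f p
   vanishes; all trigonometric polynomials qualify. *)
Let kills p := LT +oo%E p /\ forall k : int, intT (fun z => f z * (p z * z ^ k)) = 0.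

Let kills_L1 p k : LT +oo%E p -> LT 1%E (fun z => f z * (p z * z ^ k)).
Proof.
move=> lp; have := LooM_L1 (LooM lp (Loo_expz k)) lf.
by apply: eq_circle_LT => t; rewrite mulrC.
Qed.

Let kills1 : kills (fun=> 1).
Proof.
split=> [|k]; first exact: Loo_cst.
rewrite -(f0 (- k)) fourierE opprK; apply: eq_circle_intT => t.
by rewrite mul1r.
Qed.

Let killsZ (c : C) p : kills p -> kills (fun z => c * p z).
Proof.
move=> [lp kp]; split=> [|k]; first exact: (LooM (Loo_cst c) lp).
rewrite -[RHS](mulr0 c) -(kp k) -intTZ; last exact: kills_L1.
by apply: eq_circle_intT => t; ring.
Qed.

Let killsD p q : kills p -> kills q -> kills (fun z => p z + q z).
Proof.
move=> [lp kp] [lq kq]; split=> [|k]; first exact: LooD.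
rewrite -[RHS](addr0 0) -{1}(kp k) -(kq k) -intTD; [|exact: kills_L1|exact: kills_L1].
by apply: eq_circle_intT => t; ring.
Qed.

Let killsMz (m : int) p : kills p -> kills (fun z => z ^ m * p z).
Proof.
move=> [lp kp]; split=> [|k]; first exact: (LooM (Loo_expz m) lp).
rewrite -(kp (m + k)); apply: eq_circle_intT => t.
by rewrite expfzDr ?cis_neq0//; ring.
Qed.

Let rampC (a c : R) (z : C) : C :=
  (1/2 + c / 4)%:C%C - (8^-1)%:C%C * ((cis a)^*%C * z ^ 1 + cis a * z ^ (-1)).

Let rampC_real a c t : rampC a c (cis t) = (ramp a c t)%:C%C.
Proof.
rewrite /rampC /ramp !cisXz mulr1z mulrN1z -!cisN -!cisD cosB.
apply: complexP; rewrite /= !cosD !sinD ?cosN ?sinN; by field.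
Qed.

Let kills_ramp a c p : kills p -> kills (fun z => rampC a c z * p z).
Proof.
move=> kp.
have := killsD (killsZ (1/2 + c / 4)%:C%C kp) (killsZ (- (8^-1)%:C%C)
  (killsD (killsZ (cis a)^*%C (killsMz 1 kp)) (killsZ (cis a) (killsMz (-1) kp)))).
move=> [l k]; split.
  by move: l; apply: eq_circle_LT => t; rewrite /rampC; ring.
by move=> m; rewrite -(k m); apply: eq_circle_intT => t; rewrite /rampC; ring.
Qed.

Let kills_ext p q : p =1 q -> kills p -> kills q.
Proof. by move=> /funext ->. Qed.

Let kills_rampX a c n p : kills p -> kills (fun z => rampC a c z ^+ n * p z).
Proof.
move=> kp; elim: n => [|n IH].
  by apply: kills_ext kp => z; rewrite expr0 mul1r.
by apply: kills_ext (kills_ramp a c IH) => z; rewrite exprS mulrA.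
Qed.

Let kills_step a c n m : kills (fun z => (1 - rampC a c z ^+ n) ^+ m).
Proof.
elim: m => [|m IH]; first by apply: kills_ext kills1 => z; rewrite expr0.
apply: kills_ext (killsD IH (killsZ (-1) (kills_rampX a c n IH))) => z.
by rewrite exprS; ring.
Qed.

(** The multipliers used here are real on the circle, so that they can be tested
    against the real and the imaginary part of f separately. *)
Lemma fourier_eq0 : eqT f (fun=> 0).
Proof.
have key (a c : R) n t :
    (1 - rampC a c (cis t) ^+ n) ^+ (2 ^ n) = (step_poly (ramp a c t) n)%:C%C.
  by rewrite rampC_real /step_poly rmorphXn rmorphB rmorph1 rmorphXn.
have [i1 i2] := (L1P f).1 lf.
have re0 : {ae mu, forall t, reT f t = 0}.
  apply: (vanishing_ae i1) => n a c c1.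
  have /(congr1 (@complex.Re R)) := (kills_step a c n (2 ^ n)).2 0.
  rewrite /= => e; rewrite -[RHS]e; apply: eq_Rintegral => t _.
  by rewrite /reT expr0z mulr1 key reimE /= mulr0 subr0.
have im0 : {ae mu, forall t, imT f t = 0}.
  apply: (vanishing_ae i2) => n a c c1.
  have /(congr1 (@complex.Im R)) := (kills_step a c n (2 ^ n)).2 0.
  rewrite /= => e; rewrite -[RHS]e; apply: eq_Rintegral => t _.
  by rewrite /imT expr0z mulr1 key reimE /= mulr0 add0r.
rewrite /eqT /aeT; apply: filterS2 re0 im0 => t e1 e2.
by apply: complexP; rewrite /= ?[RHS]/=.
Qed.

End Uniqueness.

Lemma fourier_inj f g : LT 1%E f -> LT 1%E g ->
  (forall k, fourier f k = fourier g k) -> eqT f g.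
Proof.
move=> lf lg fg.
have : eqT (fun z => f z - g z) (fun=> 0).
  apply: fourier_eq0; first exact: L1B.
  by move=> k; rewrite fourierB// fg subrr.
by rewrite /eqT /aeT; apply: filterS => t /= /eqP; rewrite subr_eq0 => /eqP.
Qed.

End FourierCoefficients.

(** * Completeness of L^2 *)

(** The pointwise limit of a sequence of functions where it exists; the junk
    value elsewhere is chosen so as to keep the function measurable. *)
Definition lim_fun (T : Type) (R : realType) (h : nat -> T -> R) (t : T) : R :=
  fine (limn_esup (fun n => (h n t)%:E)).

Section FastCauchy.
Context d (T : measurableType d) (R : realType).
Variable mu : {measure set T -> \bar R}.
Variable h : nat -> T -> R.
Hypothesis mh : forall n, measurable_fun setT (h n).
Hypothesis ch : forall i j, (i <= j)%N ->
  (\int[mu]_t ((h j t - h i t) ^+ 2)%:E <= (16^-1 ^+ i)%:E)%E.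

Let e j t : \bar R := ((4 ^+ j) * (h j.+1 t - h j t) ^+ 2)%:E.

Let e_ge0 j t : (0 <= e j t)%E.
Proof. by rewrite lee_fin mulr_ge0 ?sqr_ge0 ?exprn_ge0. Qed.

Let me j : measurable_fun setT (e j).
Proof.
apply/measurable_EFinP; apply: measurable_funM => //; apply: measurable_funX.
exact: measurable_funB.
Qed.

(** Weighting the squared increments by 4^j keeps their sum integrable, and its
    pointwise finiteness forces the increments to decay like 2^-j. *)
Let ae_fin : {ae mu, forall t, (\sum_(j <oo) e j t)%E \is a fin_num}.
Proof.
have mS : measurable_fun setT (fun t => \sum_(j <oo) e j t)%E.
  by apply: (@ge0_emeasurable_sum _ T R setT e xpredT).
have S0 t : (0 <= \sum_(j <oo) e j t)%E by exact: nneseries_ge0.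
have : mu.-integrable setT (fun t => \sum_(j <oo) e j t)%E.
  apply/integrableP; split=> //.
  under eq_integral do rewrite gee0_abs//.
  rewrite integral_nneseries//.
  apply: (@le_lt_trans _ _ (2 : R)%:E); last exact: ltry.
  apply: lime_le; first by apply: is_cvg_nneseries => n _ _; exact: integral_ge0.
  apply: nearW => n.
  apply: (@le_trans _ _ (\sum_(0 <= j < n) (4^-1 ^+ j)%:E)%E).
    apply: lee_sum => j _; rewrite /e.
    under eq_integral do rewrite EFinM.
    rewrite ge0_integralZl//; [|by apply/measurable_EFinP; apply: measurable_funX;
      exact: measurable_funB|by move=> t _; rewrite lee_fin sqr_ge0].
    apply: (@le_trans _ _ ((4 ^+ j)%:E * (16^-1 ^+ j)%:E)%E).
      by apply: lee_wpmul2l; [rewrite lee_fin exprn_ge0|exact: ch].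
    rewrite -EFinM lee_fin -exprMn le_eqVlt; apply/orP; left; apply/eqP.
    by congr (_ ^+ _); field.
  rewrite sumEFin lee_fin.
  have := @geometric_le_lim R n 1 4^-1 ler01.
  rewrite invr_gt0 ltr0n => /(_ isT); rewrite ger0_norm ?invr_ge0//.
  rewrite invf_lt1// ltr1n => /(_ isT) H.
  under eq_bigr do rewrite -[_ ^+ _]mul1r.
  apply: (le_trans H); have -> : (1 - 4^-1)^-1 = 4 / 3 :> R by field.
  lra.
by move/(integrable_ae measurableT); apply: filterS => t /(_ I).
Qed.

Let cvg_at t : (\sum_(j <oo) e j t)%E \is a fin_num -> cvgn (h ^~ t).
Proof.
move=> fin; pose K := fine (\sum_(j <oo) e j t)%E.
have K0 : 0 <= K by apply: fine_ge0; apply: nneseries_ge0.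
have eK j : (4 ^+ j) * (h j.+1 t - h j t) ^+ 2 <= K.
  rewrite -lee_fin fineK//.
  apply: le_trans (nneseries_lim_ge j.+1 (fun n _ _ => e_ge0 n t)).
  rewrite big_nat_recr//= leeDr// sume_ge0//.
have dec j : `|h j.+1 t - h j t| <= geometric (K + 1) 2^-1 j.
  rewrite /geometric /= -(@ler_pXn2r _ 2)// ?nnegrE//; last first.
    by rewrite mulr_ge0 ?exprn_ge0 ?invr_ge0// addr_ge0.
  rewrite real_normK ?num_real// exprMn -exprM mulnC exprM.
  have p : 0 < 4 ^+ j :> R by rewrite exprn_gt0.
  have -> : (2^-1 ^+ 2) ^+ j = (4 ^+ j)^-1 :> R.
    by rewrite -exprVn; congr (_ ^+ _); field.
  rewrite ler_pdivlMr// mulrC (le_trans (eK j))//; nra.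
have -> : h ^~ t = (fun n => h 0%N t + series (telescope (h ^~ t)) n).
  by apply/funext => n; rewrite -eq_sum_telescope.
apply: is_cvgD; first exact: is_cvg_cst.
apply: normed_cvg; apply: (series_le_cvg _ _ dec) => //.
- by move=> n; rewrite geometric_ge0 ?addr_ge0 ?invr_ge0.
- by apply: is_cvg_geometric_series; rewrite ger0_norm ?invr_ge0// invf_lt1// ltr1n.
Qed.

Local Notation g := (lim_fun h).

Lemma measurable_lim_fun : measurable_fun setT g.
Proof.
apply: measurableT_comp; first exact: fine_measurable.
by apply: measurable_fun_limn_esup => n; exact/measurable_EFinP.
Qed.

Let g_lim t : cvgn (h ^~ t) -> h n t @[n --> \oo] --> g t.
Proof.
move=> /cvg_ex[l hl].
have hlE : (h n t)%:E @[n --> \oo] --> l%:E.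
  by apply/cvg_EFin => //; exact: nearW.
rewrite /lim_fun is_cvg_limn_esupE; last by apply/cvg_ex; exists l%:E.
by rewrite (cvg_lim _ hlE).
Qed.

Lemma fast_cauchy_limit i :
  (\int[mu]_t ((g t - h i t) ^+ 2)%:E <= (16^-1 ^+ i)%:E)%E.
Proof.
have mg := measurable_lim_fun.
pose f n t : \bar R := ((h (i + n)%N t - h i t) ^+ 2)%:E.
have mf n : measurable_fun setT (f n).
  by apply/measurable_EFinP; apply: measurable_funX; exact: measurable_funB.
have f0 n t : (0 <= f n t)%E by rewrite lee_fin sqr_ge0.
have F := fatou mu measurableT mf (fun n t _ => f0 n t).
apply: (@le_trans _ _ (\int[mu]_t limn_einf (f ^~ t))%E).
  rewrite le_eqVlt; apply/orP; left; apply/eqP.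
  apply: ge0_ae_eq_integral => //.
  - by apply/measurable_EFinP; apply: measurable_funX; exact: measurable_funB.
  - rewrite (_ : (fun t => _) = (fun t => - limn_esup (\- (f ^~ t))))%E//.
    apply: measurableT_comp => //; apply: measurable_fun_limn_esup => n.
    exact: measurableT_comp.
  - by move=> t _; rewrite lee_fin sqr_ge0.
  - move=> t _; rewrite limn_einf_lim; apply: lime_ge; first exact: is_cvg_einfs.
    apply: nearW => n; apply: le_ereal_inf_tmp => _ [m _ <-]; exact: f0.
  apply: filterS ae_fin => t /cvg_at/g_lim hg _.
  have : f n t @[n --> \oo] --> ((g t - h i t) ^+ 2)%:E.
    apply/cvg_EFin; first exact: nearW.
    rewrite /=; under eq_fun do rewrite /f /= expr2.
    have c : h (i + n)%N t - h i t @[n --> \oo] --> g t - h i t.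
      apply: cvgB; last exact: cvg_cst.
      rewrite (_ : (fun n => h (i + n)%N t) = [sequence (h ^~ t) (n + i)%N]_n).
        by move: hg; rewrite -(cvg_shiftn i); exact.
      by apply/funext => n; rewrite addnC.
    by rewrite expr2; apply: cvgM.
  move=> c; rewrite is_cvg_limn_einfE; last by apply/cvg_ex; eexists; exact: c.
  exact/esym/cvg_lim.
apply: (le_trans F); rewrite limn_einf_lim; apply: lime_le; first exact: is_cvg_einfs.
apply: nearW => n; apply: (@le_trans _ _ (\int[mu]_t f n t)%E).
  by apply: ereal_inf_lbound; exists n => /=.
by apply: ch; exact: leq_addr.
Qed.

End FastCauchy.

(** * The Hilbert space L^2 of the circle *)

Section InnerProduct.
Context {R : realType}.
Local Notation C := R[i].
Local Notation mu := (uniform_prob (two_pi_gt0 R)).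
Local Notation L2 := (@LT R 2%:E).
Implicit Types (f g h : C -> C).

Definition sqnorm f : R := \int[mu]_t sqmod_arc f t.
Definition sdot f g : C := intT (fun z => f z * (g z)^*%C).

Lemma fourier_sdot f k : fourier f k = sdot f (fun z => z ^ k).
Proof. by []. Qed.

Lemma L2_sdot f g : L2 f -> L2 g -> LT 1%E (fun z => f z * (g z)^*%C).
Proof. by move=> lf lg; apply: L2M => //; exact: L2_conj. Qed.

Lemma sqnorm_ge0 f : 0 <= sqnorm f.
Proof. by apply: Rintegral_ge0 => t _; exact: sqmod_ge0. Qed.

Lemma sdot_sqnorm f : sdot f f = (sqnorm f)%:C%C.
Proof.
apply: complexP; rewrite /=.
  by apply: eq_Rintegral => t _; rewrite /reT sqmodE.
under eq_Rintegral do rewrite /imT sqmodE /=.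
by rewrite Rintegral_cst// mul0r.
Qed.

Lemma sdotZl (c : C) f h : L2 f -> L2 h -> sdot (fun z => c * f z) h = c * sdot f h.
Proof.
move=> lf lh; rewrite /sdot -intTZ; last exact: L2_sdot.
by apply: eq_circle_intT => t; rewrite mulrA.
Qed.

Lemma sdotC f g : L2 f -> L2 g -> sdot g f = (sdot f g)^*%C.
Proof.
move=> lf lg; rewrite /sdot -intT_conj; last exact: L2_sdot.
apply: eq_circle_intT => t; apply: complexP; rewrite !reimE; ring.
Qed.

Lemma sdotBl f g h : L2 f -> L2 g -> L2 h ->
  sdot (fun z => f z - g z) h = sdot f h - sdot g h.
Proof.
move=> lf lg lh; rewrite /sdot -intTB; [|exact: L2_sdot|exact: L2_sdot].
by apply: eq_circle_intT => t; rewrite mulrBl.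
Qed.

Lemma conjcB (x y : C) : ((x - y : C)^*)%C = (x^*)%C - (y^*)%C.
Proof. exact: rmorphB. Qed.

Lemma sdotBr f g h : L2 f -> L2 g -> L2 h ->
  sdot h (fun z => f z - g z) = sdot h f - sdot h g.
Proof.
move=> lf lg lh; have lfg := L2B lf lg.
by rewrite sdotC// sdotBl// conjcB -!sdotC.
Qed.

Lemma sdotZr (c : C) f h : L2 f -> L2 h ->
  sdot h (fun z => c * f z) = (c^*)%C * sdot h f.
Proof.
move=> lf lh; have lcf := L2Z c lf.
by rewrite sdotC// sdotZl// conjcM -sdotC.
Qed.

Lemma sdot_sumr (I : Type) (s : seq I) (F : I -> C -> C) h :
  (forall i, L2 (F i)) -> L2 h ->
  sdot h (fun z => \sum_(i <- s) F i z) = \sum_(i <- s) sdot h (F i).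
Proof.
move=> lF lh; rewrite /sdot.
have [|_ <-] := @intT_sum R I s xpredT (fun i z => h z * (F i z)^*%C).
  by move=> i _; exact: L2_sdot.
by apply: eq_circle_intT => t; rewrite -mulr_sumr; congr (_ * _); exact: rmorph_sum.
Qed.

Lemma sqnorm_eq0 f : L2 f -> sqnorm f <= 0 -> eqT f (fun=> 0).
Proof.
move=> /L2P[_ i] f0.
have := Rintegral_eq0_ae i (fun t => sqmod_ge0 _) f0.
by rewrite /eqT /aeT; apply: filterS => t; exact: sqmod_eq0.
Qed.

Lemma sqnormB f g : L2 f -> L2 g ->
  (sqnorm (fun z => f z - g z))%:C%C =
  (sqnorm f)%:C%C - sdot f g - (sdot f g)^*%C + (sqnorm g)%:C%C.
Proof.
move=> lf lg; have lfg := L2B lf lg.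
by rewrite -!sdot_sqnorm sdotBl// !sdotBr// [sdot g f]sdotC//; ring.
Qed.

Lemma cauchy_schwarz f g : L2 f -> L2 g -> sqmod (sdot f g) <= sqnorm f * sqnorm g.
Proof.
move=> lf lg; have [g0|g0] := leP (sqnorm g) 0.
  have g00 := sqnorm_eq0 lg g0.
  suff -> : sdot f g = 0 by rewrite sqmod0 mulr_ge0 ?sqnorm_ge0.
  rewrite -(intT_cst (R:=R) 0); apply: eq_intT.
  - exact: L1_mfun (L2_sdot lf lg).
  - exact: mfunT_cst.
  - move: g00; rewrite /eqT /aeT; apply: filterS => t /= ->.
    by rewrite (_ : (0^*)%C = 0 :> C) ?mulr0//; apply: complexP; rewrite /= ?oppr0.
set l := sdot f g; pose c := (sqnorm g)^-1%:C%C * l.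
have lcg := L2Z c lg.
have : sqnorm (fun z => f z - c * g z) = sqnorm f - sqmod l / sqnorm g.
  apply: complexI; rewrite sqnormB// sdotZr// -/l.
  have -> : sqnorm (fun z => c * g z) = sqmod c * sqnorm g.
    apply: complexI; rewrite -sdot_sqnorm sdotZl// sdotZr// sdot_sqnorm mulrA sqmodE.
    by apply: complexP; rewrite !reimE /=; ring.
  rewrite /c /sqmod; apply: complexP; rewrite !reimE /=; field; exact: lt0r_neq0.
move=> e; have := sqnorm_ge0 (fun z => f z - c * g z).
by rewrite e subr_ge0 ler_pdivrMr.
Qed.

(** Orthogonality passes to L^2-limits. *)
Lemma sdot_eq0 f g : L2 f -> L2 g ->
  (forall e, 0 < e -> exists h,
    [/\ L2 h, sdot h g = 0 & sqnorm (fun z => f z - h z) <= e]) ->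
  sdot f g = 0.
Proof.
move=> lf lg H; apply: sqmod_eq0; apply/eqP; rewrite eq_le sqmod_ge0 andbT.
rewrite leNgt; apply/negP => p.
have q : 0 < sqnorm g + 1 by rewrite ltr_wpDl ?sqnorm_ge0.
have [|h [lh hg hn]] := H (sqmod (sdot f g) / (sqnorm g + 1) / 2).
  by rewrite !divr_gt0.
have lfh := L2B lf lh.
have := cauchy_schwarz lfh lg; rewrite sdotBl// hg subr0 leNgt => /negP; apply.
have r := sqnorm_ge0 g.
apply: (@le_lt_trans _ _ (sqmod (sdot f g) / (sqnorm g + 1) / 2 * sqnorm g)).
  by rewrite ler_wpM2r.
apply: (@lt_le_trans _ _ (sqmod (sdot f g) / (sqnorm g + 1) * (sqnorm g + 1))).
  have s : 0 < sqmod (sdot f g) / (sqnorm g + 1) by rewrite divr_gt0.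
  nra.
by rewrite mulfVK ?gt_eqF.
Qed.

End InnerProduct.

Section Orthonormality.
Context {R : realType}.
Local Notation C := R[i].
Local Notation mu := (uniform_prob (two_pi_gt0 R)).
Local Notation lam := (@lebesgue_measure R).

Lemma Rintegral_arc_FTC (f F : R -> R) : continuous f ->
  (forall x : R, is_derive x (1 : R) F (f x)) -> F (2 * pi) = F 0 ->
  rintegrable mu f -> \int[mu]_t f t = 0.
Proof.
move=> cf dF F0 iF; rewrite /Rintegral arc_integral//.
rewrite (@continuous_FTC2 _ f F) ?two_pi_gt0//.
- by rewrite F0 -EFinB subrr mule0.
- exact: continuous_subspaceT.
- have dFx x : derivable F x 1 by have [] := dF x.
  have cF x : {for x, continuous F}.
    by apply: differentiable_continuous; exact/derivable1_diffP.
  split=> [x _||] //.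
  + by apply: cvg_at_right_filter; exact: cF.
  + by apply: cvg_at_left_filter; exact: cF.
- by move=> x _; rewrite derive1E; exact: derive_val.
Qed.

Lemma fourier_expz0 (m : int) : m != 0 -> fourier (fun z : C => z ^ m) 0 = 0.
Proof.
move=> m0; have mr0 : m%:~R != 0 :> R by rewrite intr_eq0.
have l1 : LT 1%E (fun z : C => z ^ m) by apply: L2_L1; exact: L2_expz.
have [i1 i2] := (L1P _).1 l1.
rewrite fourierE oppr0.
have -> : intT (fun z : C => z ^ m * z ^ 0) = intT (fun z : C => z ^ m).
  by apply: eq_circle_intT => t; rewrite expr0z mulr1.
have reE : reT (fun z : C => z ^ m) = fun t => cos (m%:~R * t).
  by apply/funext => t; rewrite /reT cisXz -mulrzl.
have imE : imT (fun z : C => z ^ m) = fun t => sin (m%:~R * t).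
  by apply/funext => t; rewrite /imT cisXz -mulrzl.
have cM : continuous (fun t : R => m%:~R * t).
  by move=> x; apply: cvgM; [exact: cvg_cst|exact: cvg_id].
have per : cis (m%:~R * (2 * pi)) = 1 :> C.
  rewrite mulrzl -cisXz mulr_natl.
  by rewrite (_ : cis (pi *+ 2) = 1) ?exp1rz// /cis cos2pi sin2pi.
apply: complexP; rewrite /=.
- apply: (@Rintegral_arc_FTC _ (fun t => sin (m%:~R * t) / m%:~R)) => //.
  + by rewrite reE => x; apply: continuous_comp; [exact: cM|exact: continuous_cos].
  + move=> x; rewrite reE.
    apply: is_derive_eq; rewrite /GRing.scale /= ; field => //.
  + by move: per => [_ ->]; rewrite mulr0 sin0.
- apply: (@Rintegral_arc_FTC _ (fun t => - cos (m%:~R * t) / m%:~R)) => //.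
  + by rewrite imE => x; apply: continuous_comp; [exact: cM|exact: continuous_sin].
  + move=> x; rewrite imE.
    apply: is_derive_eq; rewrite /GRing.scale /=; field => //.
  + by move: per => [-> _]; rewrite mulr0 cos0.
Qed.

Lemma fourier_expz (m k : int) : fourier (fun z : C => z ^ m) k = (m == k)%:R.
Proof.
have [->|mk] := eqVneq m k.
  rewrite fourierE -[RHS](intT_cst (R:=R) 1); apply: eq_circle_intT => t.
  by rewrite -expfzDr ?cis_neq0// subrr expr0z.
have <- : fourier (fun z : C => z ^ (m - k)) 0 = (false)%:R.
  by apply: fourier_expz0; rewrite subr_eq0.
have <- : fourier (fun z : C => z ^ m * z ^ (- k)) 0 = fourier (fun z : C => z ^ m) k.
  by rewrite (fourierM_expz (fun z => z ^ m)) sub0r opprK.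
by apply: eq_circle_fourier => t; rewrite expfzDr ?cis_neq0.
Qed.

Lemma fourier_cst (c : C) k : fourier (fun=> c) k = c * (k == 0)%:R.
Proof.
have <- : fourier (fun z : C => c * z ^ 0) k = fourier (fun=> c) k.
  by apply: eq_circle_fourier => t; rewrite expr0z mulr1.
rewrite fourierZ ?fourier_expz 1?eq_sym//; apply: L2_L1; exact: L2_expz.
Qed.

End Orthonormality.

(** * Fourier series: Bessel, Riesz-Fischer and Parseval *)

Section RieszFischer.
Context {R : realType}.
Local Notation C := R[i].
Local Notation mu := (uniform_prob (two_pi_gt0 R)).
Local Notation L2 := (@LT R 2%:E).
Implicit Types (f g h : C -> C) (c : int -> C) (s : seq nat).

(** Any enumeration of the frequencies would serve, since sums over them are only
    taken along finite sequences; this one has an explicit inverse. *)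
Definition freq (i : nat) : int := if odd i then Negz i./2 else Posz i./2.

Definition rank_freq (k : int) : nat :=
  match k with Posz n => n.*2 | Negz n => n.*2.+1 end.

Lemma rank_freqK : cancel rank_freq freq.
Proof.
case=> n; rewrite /freq /= ?odd_double ?doubleK//=.
by rewrite uphalf_double.
Qed.

Lemma freqK : cancel freq rank_freq.
Proof.
move=> i; rewrite /freq; case: ifPn => oi /=.
  by rewrite -[RHS]odd_double_half oi.
by rewrite -[RHS]odd_double_half (negbTE oi).
Qed.

Lemma freq_eq i j : (freq i == freq j) = (i == j).
Proof. by rewrite (inj_eq (can_inj freqK)). Qed.

Definition trig c s (z : C) : C := \sum_(i <- s) c (freq i) * z ^ freq i.

Lemma L2_trig c s : L2 (trig c s).
Proof. by apply: L2_sum => i _; apply: L2Z; exact: L2_expz. Qed.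

Lemma fourier_trig c s (i : nat) : uniq s ->
  fourier (trig c s) (freq i) = if i \in s then c (freq i) else 0.
Proof.
move=> us; rewrite fourier_sum; last first.
  by move=> j; apply: L2_L1; apply: L2Z; exact: L2_expz.
under eq_bigr => j _.
  rewrite fourierZ; last by apply: L2_L1; exact: L2_expz.
  rewrite fourier_expz freq_eq; over.
case: ifPn => si.
  rewrite (bigD1_seq i)//= eqxx mulr1 big1 ?addr0// => j /negbTE ->.
  by rewrite mulr0.
rewrite big_seq big1// => j js; case: eqP => [ji|]; last by rewrite mulr0.
by rewrite -ji js in si.
Qed.

Lemma sdot_trig f c s : L2 f ->
  sdot f (trig c s) = \sum_(i <- s) (c (freq i))^*%C * fourier f (freq i).
Proof.
move=> lf; rewrite /trig sdot_sumr//; last first.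
  by move=> j; apply: L2Z; exact: L2_expz.
by apply: eq_bigr => j _; rewrite sdotZr//; exact: L2_expz.
Qed.

Lemma sqnorm_trig c s : uniq s -> sqnorm (trig c s) = \sum_(i <- s) sqmod (c (freq i)).
Proof.
move=> us; apply: complexI; rewrite -sdot_sqnorm sdot_trig; last exact: L2_trig.
rewrite rmorph_sum /= big_seq [RHS]big_seq; apply: eq_bigr => i si.
by rewrite fourier_trig// si mulrC sqmodE.
Qed.

Lemma sdot_trig_fourier f s : L2 f ->
  sdot f (trig (fourier f) s) = (\sum_(i <- s) sqmod (fourier f (freq i)))%:C%C.
Proof.
move=> lf; rewrite sdot_trig// rmorph_sum /=; apply: eq_bigr => i _.
by rewrite mulrC sqmodE.
Qed.

(** Pythagoras: f minus its partial sum is orthogonal to that sum. *)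
Lemma sqnormB_trig f s : L2 f -> uniq s ->
  sqnorm (fun z => f z - trig (fourier f) s z) =
  sqnorm f - \sum_(i <- s) sqmod (fourier f (freq i)).
Proof.
move=> lf us; apply: complexI; rewrite sqnormB//; last exact: L2_trig.
rewrite sdot_trig_fourier// sqnorm_trig//.
by apply: complexP; rewrite !reimE /=; ring.
Qed.

Lemma bessel f s : L2 f -> uniq s ->
  \sum_(i <- s) sqmod (fourier f (freq i)) <= sqnorm f.
Proof. by move=> lf us; rewrite -subr_ge0 -sqnormB_trig// sqnorm_ge0. Qed.

Lemma sqmod_reB f g t : (reT f t - reT g t) ^+ 2 <= sqmod (f (cis t) - g (cis t)).
Proof. by rewrite /sqmod !reimE /reT lerDl sqr_ge0. Qed.

Lemma sqmod_imB f g t : (imT f t - imT g t) ^+ 2 <= sqmod (f (cis t) - g (cis t)).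
Proof. by rewrite /sqmod !reimE /imT lerDr sqr_ge0. Qed.

Lemma EFin_sqnorm f : L2 f -> (sqnorm f)%:E = (\int[mu]_t (sqmod_arc f t)%:E)%E.
Proof. by move=> /L2P[_ i]; rewrite /sqnorm /Rintegral fineK//;
  exact: integrable_fin_num. Qed.

(** The limit is taken pointwise on the complex plane, not on the real line of
    angles, so that it is again a function on the circle. *)
Lemma L2_complete (h : nat -> C -> C) : (forall n, L2 (h n)) ->
  (forall i j, (i <= j)%N -> sqnorm (fun z => h j z - h i z) <= 16^-1 ^+ i) ->
  exists2 g, L2 g & forall i, sqnorm (fun z => g z - h i z) <= 2 * 16^-1 ^+ i.
Proof.
move=> lh ch.
pose g (z : C) : C := (lim_fun (fun n z => complex.Re (h n z)) z +i*
                       lim_fun (fun n z => complex.Im (h n z)) z)%C.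
have m1 n : measurable_fun setT (reT (h n)) by have [] := L2_mfun (lh n).
have m2 n : measurable_fun setT (imT (h n)) by have [] := L2_mfun (lh n).
have msq n m : measurable_fun setT (fun t => sqmod (h n (cis t) - h m (cis t))).
  have := L2B (lh n) (lh m) => /L2_mfun; exact: mfunT_sqmod.
have c1 i j : (i <= j)%N ->
    (\int[mu]_t ((reT (h j) t - reT (h i) t) ^+ 2)%:E <= (16^-1 ^+ i)%:E)%E.
  move=> ij; have := ch _ _ ij; rewrite -lee_fin EFin_sqnorm; last exact: L2B.
  apply: le_trans; apply: ge0_le_integral => //=.
  - by move=> t _; rewrite lee_fin sqr_ge0.
  - by apply/measurable_EFinP; apply: measurable_funX; apply: measurable_funB;
      exact: m1.
  - by apply/measurable_EFinP; exact: msq.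
  - by move=> t _; rewrite lee_fin; exact: sqmod_reB.
have c2 i j : (i <= j)%N ->
    (\int[mu]_t ((imT (h j) t - imT (h i) t) ^+ 2)%:E <= (16^-1 ^+ i)%:E)%E.
  move=> ij; have := ch _ _ ij; rewrite -lee_fin EFin_sqnorm; last exact: L2B.
  apply: le_trans; apply: ge0_le_integral => //=.
  - by move=> t _; rewrite lee_fin sqr_ge0.
  - by apply/measurable_EFinP; apply: measurable_funX; apply: measurable_funB;
      exact: m2.
  - by apply/measurable_EFinP; exact: msq.
  - by move=> t _; rewrite lee_fin; exact: sqmod_imB.
have mg : mfunT g.
  by split; [exact: (measurable_lim_fun m1)|exact: (measurable_lim_fun m2)].
have f1 := @fast_cauchy_limit _ _ _ mu (fun n => reT (h n)) m1 c1.
have f2 := @fast_cauchy_limit _ _ _ mu (fun n => imT (h n)) m2 c2.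
have sqE i t : sqmod (g (cis t) - h i (cis t)) =
    (reT g t - reT (h i) t) ^+ 2 + (imT g t - imT (h i) t) ^+ 2.
  by rewrite /sqmod !reimE.
have mre i : measurable_fun setT (fun t => (reT g t - reT (h i) t) ^+ 2).
  by apply: measurable_funX; apply: measurable_funB => //; case: mg.
have mim i : measurable_fun setT (fun t => (imT g t - imT (h i) t) ^+ 2).
  by apply: measurable_funX; apply: measurable_funB => //; case: mg.
have bnd i : (\int[mu]_t (sqmod (g (cis t) - h i (cis t)))%:E <= (2 * 16^-1 ^+ i)%:E)%E.
  under eq_integral do rewrite sqE EFinD.
  rewrite ge0_integralD//; last 4 first.
  - by move=> t _; rewrite lee_fin sqr_ge0.
  - by apply/measurable_EFinP; exact: mre.
  - by move=> t _; rewrite lee_fin sqr_ge0.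
  - by apply/measurable_EFinP; exact: mim.
  have -> : 2 * 16^-1 ^+ i = 16^-1 ^+ i + 16^-1 ^+ i :> R by rewrite mulr_natl mulr2n.
  rewrite EFinD; apply: leeD; [exact: f1|exact: f2].
have lgh i : L2 (fun z => g z - h i z).
  apply/L2P; split.
    apply: mfunTD => //; have := L2_mfun (L2N (lh i)); exact.
  apply/integrableP; split.
    apply/measurable_EFinP; rewrite (_ : sqmod_arc _ = fun t =>
      (reT g t - reT (h i) t) ^+ 2 + (imT g t - imT (h i) t) ^+ 2).
      by apply: measurable_funD; [exact: mre|exact: mim].
    by apply/funext => t; exact: sqE.
  under eq_integral do rewrite /= ger0_norm ?sqmod_ge0//.
  exact: le_lt_trans (bnd i) (ltry _).
exists g.
  have := L2D (lgh 0%N) (lh 0%N); apply: eq_circle_LT => t; exact: subrK.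
by move=> i; rewrite -lee_fin EFin_sqnorm; [exact: bnd|exact: lgh].
Qed.

Lemma bounded_tail (a : nat -> R) (B : R) : (forall n, 0 <= a n) ->
  (forall n, \sum_(i < n) a i <= B) -> forall e, 0 < e -> exists N, forall m,
  (N <= m)%N -> \sum_(N <= i < m) a i <= e.
Proof.
move=> a0 aB e e0; pose A n := \sum_(i < n) a i.
have sA : has_sup (range A).
  by split; [exists (A 0%N); exists 0%N|exists B => _ [n _ <-]; exact: aB].
have [_ [N _ <-] hN] := sup_adherent e0 sA.
exists N => m Nm.
have : A m <= sup (range A) by apply: sup_upper_bound => //; exists m.
rewrite /A -(big_mkord xpredT a) (big_cat_nat _ Nm)//= big_mkord -/(A N).
lra.
Qed.

(** The partial sums are taken along a subsequence whose increments decay fast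
    enough for almost everywhere convergence. *)
Theorem riesz_fischer c (B : R) :
  (forall n, \sum_(i < n) sqmod (c (freq i)) <= B) ->
  exists g, [/\ L2 g, forall k, fourier g k = c k &
    forall e, 0 < e -> exists s, uniq s /\ sqnorm (fun z => g z - trig c s z) <= e].
Proof.
move=> cB; pose a i := sqmod (c (freq i)).
have a0 i : 0 <= a i by exact: sqmod_ge0.
have P j : exists N, forall m, (N <= m)%N -> \sum_(N <= i < m) a i <= 16^-1 ^+ j.
  by apply: (@bounded_tail a B) => //; rewrite exprn_gt0// invr_gt0.
have [N hN] := choice P.
(* The ranks N j need not be increasing; their successive sums are, they dominate
   N j, and they are unbounded. *)
pose M j := (\sum_(i < j.+1) (N i).+1)%N.
have M_mono i j : (i <= j)%N -> (M i <= M j)%N.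
  move=> ij; rewrite /M -!(big_mkord xpredT (fun i => (N i).+1)).
  by rewrite [leqRHS](big_cat_nat _ (_ : (i.+1 <= j.+1)%N))//= leq_addr.
have NM j : (N j <= M j)%N.
  by rewrite /M big_ord_recr /= (leq_trans (leqnSn _))// leq_addl.
have jM j : (j < M j)%N.
  rewrite /M; elim: j => [|j IH]; first by rewrite big_ord_recr big_ord0.
  by rewrite big_ord_recr /= addnS ltnS (leq_trans IH)// leq_addr.
pose h j := trig c (index_iota 0 (M j)).
have lh j : L2 (h j) by exact: L2_trig.
have ch i j : (i <= j)%N -> sqnorm (fun z => h j z - h i z) <= 16^-1 ^+ i.
  move=> ij; have Mij := M_mono _ _ ij.
  have -> : (fun z => h j z - h i z) = trig c (index_iota (M i) (M j)).
    apply/funext => z; rewrite /h /trig (big_cat_nat _ Mij)//=.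
    by rewrite addrAC subrr add0r.
  rewrite sqnorm_trig ?iota_uniq//.
  apply: le_trans (hN i (M j) (leq_trans (NM i) Mij)).
  rewrite [leRHS](big_cat_nat _ Mij) ?NM//= lerDr.
  by apply: sumr_ge0 => l _.
have [g lg gh] := L2_complete lh ch.
have small (e : R) : 0 < e -> exists j0, forall j, (j0 <= j)%N -> 2 * 16^-1 ^+ j <= e.
  move=> e0; have : 2 * 16^-1 ^+ j @[j --> \oo] --> (0 : R).
    rewrite -(mulr0 2); apply: cvgM; first exact: cvg_cst.
    by apply: cvg_expr; rewrite ger0_norm ?invr_ge0// invf_lt1// ltr1n.
  move=> /cvgrPdist_le /(_ _ e0) [j0 _ H]; exists j0 => j jj0.
  have pos : 0 <= 2 * 16^-1 ^+ j :> R by rewrite mulr_ge0 ?exprn_ge0 ?invr_ge0.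
  by have := H j jj0; rewrite /= sub0r normrN (ger0_norm pos).
exists g; split=> //; last first.
  move=> e /small[j H]; exists (index_iota 0 (M j)); split; first exact: iota_uniq.
  exact: le_trans (gh j) (H _ (leqnn _)).
move=> k; apply/eqP; rewrite -subr_eq0; apply/eqP; apply: sqmod_eq0.
apply/eqP; rewrite eq_le sqmod_ge0 andbT leNgt; apply/negP => p.
set i := rank_freq k; have ki : k = freq i by rewrite rank_freqK.
have [j0 H] := small (sqmod (fourier g k - c k) / 2) ltac:(by rewrite divr_gt0).
pose j := maxn j0 i.
have fh : fourier (h j) k = c k.
  rewrite ki fourier_trig ?iota_uniq// mem_index_iota /= (leq_trans _ (jM j))//.
  by rewrite ltnS leq_maxr.
have lk : L2 (fun z => z ^ k) by exact: L2_expz.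
have := cauchy_schwarz (L2B lg (lh j)) lk.
have -> : sqnorm (fun z : C => z ^ k) = 1.
  apply: complexI; rewrite -sdot_sqnorm -fourier_sdot fourier_expz eqxx.
  by apply: complexP.
rewrite -fourier_sdot fourierB ?fh; [|exact: L2_L1|exact: L2_L1].
have := gh j; have := H j (leq_maxl _ _); lra.
Qed.

Lemma L2_approx f e : L2 f -> 0 < e ->
  exists s, uniq s /\ sqnorm (fun z => f z - trig (fourier f) s z) <= e.
Proof.
move=> lf e0.
have [|g [lg fg ag]] := @riesz_fischer (fourier f) (sqnorm f).
  by move=> n; rewrite -(big_mkord xpredT (fun i => sqmod (fourier f (freq i))))
    bessel ?iota_uniq.
have [s [us gs]] := ag _ e0; exists s; split=> //.
suff -> : sqnorm (fun z => f z - trig (fourier f) s z) =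
    sqnorm (fun z => g z - trig (fourier f) s z) by [].
have gf : eqT g f by apply: fourier_inj => //; exact: L2_L1.
have lt := L2_trig (fourier f) s.
apply: eq_ae_Rintegral.
- by have [] := (L2P _).1 (L2B lf lt) => m _; exact: mfunT_sqmod m.
- by have [] := (L2P _).1 (L2B lg lt) => m _; exact: mfunT_sqmod m.
- by move: gf; rewrite /eqT /aeT; apply: filterS => t; rewrite /sqmod_arc /= => ->.
Qed.

(** A weak form of Parseval's identity: the partial sums of f are visibly
    orthogonal to g, and they approximate f. *)
Theorem disjoint_spectrum_orthogonal f g : L2 f -> L2 g ->
  (forall k, fourier f k = 0 \/ fourier g k = 0) -> sdot f g = 0.
Proof.
move=> lf lg fg; apply: sdot_eq0 => // e e0.
have [s [us H]] := L2_approx lf e0.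
have lt := L2_trig (fourier f) s.
exists (trig (fourier f) s); split=> //.
rewrite sdotC// sdot_trig// big1 ?conjc0// => i _.
case: (fg (freq i)) => ->; last by rewrite mulr0.
by rewrite conjc0 mul0r.
Qed.

End RieszFischer.

(** * Reflection of the circle *)

Section Reflection.
Context {R : realType}.
Local Notation C := R[i].
Local Notation mu := (uniform_prob (two_pi_gt0 R)).
Local Notation lam := (@lebesgue_measure R).
Local Notation D := (`[0, 2 * pi]%classic : set R).
Implicit Types (f g : C -> C).

(** Complex conjugation of the circle in the angular variable, in the form that
    maps [0, 2 pi] to itself. *)
Definition refl (t : R) : R := 2 * pi - t.

Lemma measurable_refl : @measurable_fun _ _ (measurableTypeR R) (measurableTypeR R)
  setT refl.
Proof. exact: measurable_funB. Qed.

Lemma cis_refl (t : R) : cis (refl t) = (cis t)^*%C.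
Proof. by rewrite cis2pi cisN. Qed.

Lemma lebesgue_refl (A : set R) : measurable A ->
  pushforward lam (refl : _ -> measurableTypeR R) A = lam A.
Proof.
have mr := measurable_refl.
move=> mA; apply/esym/lebesgue_measure_unique => //= _ [[a b]] _ <-.
rewrite /pushforward (_ : refl @^-1` _ = `[2 * pi - b, 2 * pi - a[%classic).
  rewrite !lebesgue_measure_itv/= !lte_fin ltrD2l ltrN2.
  by case: ifP => // _; rewrite -!EFinB; congr EFin; ring.
apply/seteqP; split=> t; rewrite /refl /= !in_itv /= => /andP[p q];
  by apply/andP; split; lra.
Qed.

Lemma ge0_arc_refl (F : R -> \bar R) : measurable_fun setT F ->
  (forall t, 0 <= F t)%E -> (\int[mu]_t F (refl t) = \int[mu]_t F t)%E.
Proof.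
move=> mF F0; have mr := measurable_refl.
rewrite !arc_ge0_integral//; last exact: (measurableT_comp mF mr).
congr (_ * _)%E.
have -> : D = (refl : _ -> measurableTypeR R) @^-1` D.
  apply/seteqP; split=> t; rewrite /refl /= !in_itv /= => /andP[p q];
  by apply/andP; split; lra.
rewrite -[LHS](@ge0_integral_pushforward _ _ _ _ _ _ mr lam D F)//; last first.
  exact: measurable_funTS.
rewrite (_ : _ @^-1` D = D).
  by apply: eq_measure_integral => A mA _; exact: lebesgue_refl.
apply/seteqP; split=> t; rewrite /refl /= !in_itv /= => /andP[p q];
  by apply/andP; split; lra.
Qed.

Lemma Rintegral_arc_refl (h : R -> R) : measurable_fun setT h ->
  \int[mu]_t h (refl t) = \int[mu]_t h t.
Proof.
move=> mh; have mh' : measurable_fun setT (EFin \o h) by exact/measurable_EFinP.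
congr fine; rewrite [LHS]integralE [RHS]integralE.
congr (_ - _)%E.
- apply: etrans (ge0_arc_refl (measurable_funepos mh') (fun=> funepos_ge0 _ _)).
  by apply: eq_integral => t _; rewrite !funeposE.
- apply: etrans (ge0_arc_refl (measurable_funeneg mh') (fun=> funeneg_ge0 _ _)).
  by apply: eq_integral => t _; rewrite !funenegE.
Qed.

Lemma rintegrable_arc_refl (h : R -> R) : rintegrable mu h ->
  rintegrable mu (fun t => h (refl t)).
Proof.
move=> /integrableP[mh ih]; apply/integrableP; split.
  exact: (measurableT_comp mh measurable_refl).
have m : measurable_fun setT (fun t => `|(h t)%:E|)%E by exact: measurableT_comp.
by have -> := ge0_arc_refl m (fun=> abse_ge0 _).
Qed.

Lemma reT_refl f : reT (fun z => f (z^*)%C) = fun t => reT f (refl t).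
Proof. by apply/funext => t; rewrite /reT cis_refl. Qed.

Lemma imT_refl f : imT (fun z => f (z^*)%C) = fun t => imT f (refl t).
Proof. by apply/funext => t; rewrite /imT cis_refl. Qed.

Lemma intT_refl f : mfunT f -> intT (fun z => f (z^*)%C) = intT f.
Proof.
move=> [m1 m2]; rewrite /intT reT_refl imT_refl.
by rewrite (Rintegral_arc_refl m1) (Rintegral_arc_refl m2).
Qed.

Lemma L2_refl f : LT 2%:E f -> LT 2%:E (fun z => f (z^*)%C).
Proof.
move=> /L2P[m i]; apply/L2P; split; first exact: mfunT_refl.
rewrite (_ : sqmod_arc _ = fun t => sqmod_arc f (refl t)).
  exact: rintegrable_arc_refl.
by apply/funext => t; rewrite /sqmod_arc cis_refl.
Qed.

Lemma L2_flip f : LT 2%:E f -> LT 2%:E (fun z => (z^*)%C * f (z^*)%C).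
Proof.
move=> lf; have := L2_refl (L2M_expz 1 lf).
by apply: eq_circle_LT => t; rewrite expr1z mulrC.
Qed.

Lemma fourier_flip f k : LT 2%:E f ->
  fourier (fun z => (z^*)%C * f (z^*)%C) k = fourier f (- k - 1).
Proof.
move=> lf; rewrite [RHS]fourierE -intT_refl; last first.
  exact: L2_mfun (L2M_expz _ lf).
rewrite fourierE; apply: eq_circle_intT => t.
rewrite -cisN !cisXz.
have -> : cis (- t *~ - (- k - 1)) = cis (- t) * cis (t *~ - k).
  rewrite -cisD; congr cis.
  by rewrite opprB opprK mulrzDr mulr1z mulNrz mulrNz.
by rewrite mulrCA mulrA.
Qed.

End Reflection.

(** * Hardy classes *)

Section HardyProducts.
Context {R : realType}.
Local Notation C := R[i].
Local Notation mu := (uniform_prob (two_pi_gt0 R)).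
Local Notation L2 := (@LT R 2%:E).
Local Notation H2s := (@HT R 2%:E).
Local Notation Hoo := (@HT R +oo%E).
Implicit Types (f g theta : C -> C).

Lemma eqT_ext (V : Type) (f g : C -> V) : (forall t, f (cis t) = g (cis t)) -> eqT f g.
Proof. by move=> fg; apply: aeW => t /=; exact: fg. Qed.

Lemma eqT_trans (V : Type) (f g h : C -> V) : eqT f g -> eqT g h -> eqT f h.
Proof. by rewrite /eqT /aeT; apply: filterS2 => t /= -> ->. Qed.

Lemma eqT_forall (V : Type) (I : finType) (f g : I -> C -> V) :
  (forall i, eqT (f i) (g i)) -> aeT [set z | forall i, f i z = g i z].
Proof.
by move=> h; rewrite /aeT; apply: filter_forall => i; exact: h.
Qed.

Lemma eqT_sum0 (I : finType) (F : I -> C -> C) : (forall i, eqT (F i) (fun=> 0)) ->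
  eqT (fun z => \sum_i F i z) (fun=> 0).
Proof.
move=> /eqT_forall; rewrite /eqT /aeT; apply: filterS => t /= h.
by rewrite big1.
Qed.

(** The k-th coefficient of f g is formally the convolution of the coefficients
    f^(j) and g^(k - j); when all its terms vanish, f is orthogonal to the
    conjugate of g z^-k by disjointness of spectra, and no series is needed. *)
Lemma fourierM_eq0 f g k : L2 f -> L2 g ->
  (forall j, fourier f j = 0 \/ fourier g (k - j) = 0) ->
  fourier (fun z => f z * g z) k = 0.
Proof.
move=> lf lg fg; pose h (z : C) := (g z)^*%C * z ^ k.
have lh : L2 h by apply: L2M_expz; exact: L2_conj.
have -> : fourier (fun z => f z * g z) k = sdot f h.
  rewrite fourierE; apply: eq_circle_intT => t.
  by rewrite /h conjcM conjcK conj_cisXz mulrA.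
apply: disjoint_spectrum_orthogonal => // j.
have [->|e] := fg j; first by left.
right; rewrite /h (fourierM_expz (fun z => (g z)^*%C)) fourierJ; last exact: L2_L1.
by rewrite opprB e conjc0.
Qed.

Lemma hardyM_neg f g k : H2s f -> H2s g -> k < 0 ->
  fourier (fun z => f z * g z) k = 0.
Proof.
move=> [lf f0] [lg g0] k0; apply: fourierM_eq0 => // j.
have [j0|j0] := ltP j 0; first by left; exact: f0.
by right; apply: g0; rewrite subr_lt0 (lt_le_trans k0).
Qed.

(** The mean is the value at the origin of the holomorphic extension, hence
    multiplicative; f is split as its mean plus a function vanishing there. *)
Lemma hardyM_0 f g : H2s f -> H2s g ->
  fourier (fun z => f z * g z) 0 = fourier f 0 * fourier g 0.
Proof.
move=> [lf f0] [lg g0]; set c := fourier f 0.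
have lfc : L2 (fun z => f z - c) by apply: L2B => //; exact: L2_cst.
have <- : fourier (fun z => (f z - c) * g z + c * g z) 0 =
    fourier (fun z => f z * g z) 0.
  by apply: eq_circle_fourier => t; ring.
rewrite fourierD; [|exact: L2M|by apply: L1Z; exact: L2_L1].
rewrite fourierZ; last exact: L2_L1.
rewrite (@fourierM_eq0 (fun z => f z - c))// ?add0r// => j.
have [j0|j0] := leP j 0; last by right; apply: g0; rewrite sub0r oppr_lt0.
left; rewrite fourierB; [|exact: L2_L1|by apply: L2_L1; exact: L2_cst].
rewrite fourier_cst; have [->|jN] := eqVneq j 0; first by rewrite mulr1 subrr.
by rewrite f0 ?mulr0 ?subrr// lt_neqAle jN.
Qed.

Lemma Hoo_H2 f : Hoo f -> H2s f.
Proof. by move=> [lf f0]; split=> //; exact: Loo_L2. Qed.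

Lemma HooM_H2 f g : Hoo f -> H2s g -> H2s (fun z => f z * g z).
Proof.
move=> hf hg; split; first by apply: LooM_L2; [case: hf|case: hg].
by move=> k k0; apply: hardyM_neg => //; exact: Hoo_H2.
Qed.

Lemma HooM f g : Hoo f -> Hoo g -> Hoo (fun z => f z * g z).
Proof.
move=> hf hg; split; first by apply: LooM; [case: hf|case: hg].
by move=> k k0; apply: hardyM_neg => //; exact: Hoo_H2.
Qed.

Lemma HooD f g : Hoo f -> Hoo g -> Hoo (fun z => f z + g z).
Proof.
move=> [lf f0] [lg g0]; split=> [|k k0]; first exact: LooD.
rewrite fourierD; [|by apply: L2_L1; exact: Loo_L2|by apply: L2_L1; exact: Loo_L2].
by rewrite f0// g0// addr0.
Qed.

Lemma Hoo_cst (c : C) : Hoo (fun=> c).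
Proof.
split=> [|k k0]; first exact: Loo_cst.
by rewrite fourier_cst lt_eqF// mulr0.
Qed.

Lemma HooN f : Hoo f -> Hoo (fun z => - f z).
Proof. by move=> /(HooM (Hoo_cst (-1))); under eq_fun do rewrite mulN1r. Qed.

Lemma Hoo_sum (I : Type) (s : seq I) (P : pred I) (F : I -> C -> C) :
  (forall i, Hoo (F i)) -> Hoo (fun z => \sum_(i <- s | P i) F i z).
Proof.
move=> h; elim: s => [|i s IH].
  by under eq_fun do rewrite big_nil; exact: Hoo_cst.
under eq_fun do rewrite big_cons.
by case: (P i) => //; apply: HooD.
Qed.

Lemma Hoo_prod (I : Type) (s : seq I) (P : pred I) (F : I -> C -> C) :
  (forall i, Hoo (F i)) -> Hoo (fun z => \prod_(i <- s | P i) F i z).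
Proof.
move=> h; elim: s => [|i s IH].
  by under eq_fun do rewrite big_nil; exact: Hoo_cst.
under eq_fun do rewrite big_cons.
by case: (P i) => //; apply: HooM.
Qed.

Lemma H2_expzM f (m : nat) : H2s f -> H2s (fun z => f z * z ^ m%:Z).
Proof.
move=> [lf f0]; split; first exact: L2M_expz.
by move=> k k0; rewrite fourierM_expz f0// subr_lt0 (lt_le_trans k0).
Qed.

Lemma H2_shift f (m : int) : L2 f -> (forall j, j < m -> fourier f j = 0) ->
  H2s (fun z => f z * z ^ (- m)).
Proof.
move=> lf f0; split; first exact: L2M_expz.
by move=> k k0; rewrite fourierM_expz opprK f0// gtrDr.
Qed.

(** The order of vanishing at the origin of the holomorphic extension. *)
Lemma hardy_order f : H2s f -> ~ eqT f (fun=> 0) ->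
  exists m : int, fourier f m != 0 /\ forall j, j < m -> fourier f j = 0.
Proof.
move=> [lf f0] fN.
have : exists n : nat, fourier f n%:Z != 0.
  apply: contrapT => /forallNP h; apply: fN; apply: fourier_eq0; first exact: L2_L1.
  move=> k; have [k0|] := ltP k 0; first exact: f0.
  by case: k => // n _; apply/eqP; have /negP := h n; rewrite negbK.
move=> /cid ex; have := ex_minnP (ex_intro _ _ (svalP ex)).
case=> n fn mn; exists n%:Z; split=> // j.
case: j => // [j|j _]; last exact: f0.
rewrite ltz_nat => jn; apply/eqP; apply: contraTT jn => /mn.
by rewrite -leqNgt.
Qed.

(** The lowest coefficients of two nonzero Hardy functions multiply. *)
Lemma hardy_integral f g : H2s f -> H2s g -> eqT (fun z => f z * g z) (fun=> 0) ->
  eqT f (fun=> 0) \/ eqT g (fun=> 0).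
Proof.
move=> hf hg fg.
have [|/(hardy_order hf)[m [fm fm0]]] := pselect (eqT f (fun=> 0)); first by left.
have [|/(hardy_order hg)[l [gl gl0]]] := pselect (eqT g (fun=> 0)); first by right.
exfalso; have [lf _] := hf; have [lg _] := hg.
have hf' := H2_shift lf fm0; have hg' := H2_shift lg gl0.
have := hardyM_0 hf' hg'; rewrite !fourierM_expz !sub0r !opprK => /eqP.
rewrite (_ : fourier _ 0 = 0).
  by rewrite eq_sym mulf_eq0 (negbTE fm) (negbTE gl).
rewrite -[RHS](mul0r ((0 : int) == 0)%:R) -fourier_cst.
apply: eq_fourier.
- apply: L1_mfun; apply: L2M; [by case: hf'|by case: hg'].
- exact: mfunT_cst.
move: fg; rewrite /eqT /aeT; apply: filterS => t /= e.
by rewrite mulrACA e mul0r.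
Qed.

End HardyProducts.

Section InnerDivisibility.
Context {R : realType}.
Local Notation C := R[i].
Local Notation mu := (uniform_prob (two_pi_gt0 R)).
Local Notation L2 := (@LT R 2%:E).
Local Notation H2s := (@HT R 2%:E).
Local Notation Hoo := (@HT R +oo%E).
Implicit Types (f g theta : C -> C).

Lemma eq_sqnorm f g : L2 f -> L2 g -> aeT [set z | sqmod (f z) = sqmod (g z)] ->
  sqnorm f = sqnorm g.
Proof.
move=> /L2P[m1 _] /L2P[m2 _] fg; apply: eq_ae_Rintegral.
- exact: mfunT_sqmod.
- exact: mfunT_sqmod.
- exact: fg.
Qed.

Lemma inner_sqn theta : inner_function theta -> aeT [set z | sqmod (theta z) = 1].
Proof.
move=> [_]; rewrite /aeT; apply: filterS => t /= h.
by apply: complexI; rewrite -sqmod_norm h expr1n.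
Qed.

Lemma inner_neq0 theta : inner_function theta -> aeT [set z | theta z != 0].
Proof.
move=> /inner_sqn; rewrite /aeT; apply: filterS => t /= h.
apply/eqP => z; move: h; rewrite z sqmod0 => /eqP.
by rewrite eq_sym oner_eq0.
Qed.

(** The strict maximum principle at the origin: equality would make theta equal
    to its mean. *)
Lemma inner_mean_lt1 theta : inner_function theta -> nonconstant theta ->
  sqmod (fourier theta 0) < 1.
Proof.
move=> hi nc; set c := fourier theta 0; rewrite ltNge; apply/negP => c1; apply: nc.
have [[loo _] _] := hi; have l2 := Loo_L2 loo; have lc := L2_cst c.
have n1 : sqnorm theta = 1.
  have -> : sqnorm theta = sqnorm (fun=> 1).
    apply: eq_sqnorm => //; first exact: L2_cst.
    by have := inner_sqn hi; rewrite /aeT; apply: filterS => t /=; rewrite sqmod1.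
  by apply: complexI; rewrite -sdot_sqnorm /sdot intT_cst conjc1 mulr1.
exists c; have := @sqnorm_eq0 R (fun z => theta z - c) (L2B l2 lc).
have -> : sqnorm (fun z => theta z - c) = 1 - sqmod c.
  apply: complexI; rewrite sqnormB// n1.
  have -> : sdot theta (fun=> c) = (sqmod c)%:C%C.
    rewrite -sqmodE mulrC {3}/c fourierE oppr0 /sdot -intTZ; last first.
      by apply: L1M_expz; exact: L2_L1.
    by apply: eq_circle_intT => t; rewrite expr0z mulr1 mulrC.
  have -> : sqnorm (fun=> c) = sqmod c.
    by apply: complexI; rewrite -sdot_sqnorm /sdot intT_cst sqmodE.
  by apply: complexP; rewrite !reimE /=; ring.
rewrite subr_le0 => /(_ c1); rewrite /eqT /aeT; apply: filterS => t /= /eqP.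
by rewrite subr_eq0 => /eqP.
Qed.

Section Divisible.
Variable theta : C -> C.
Hypothesis hi : inner_function theta.
Hypothesis nc : nonconstant theta.

(* Every member is theta times another member, hence a multiple of every power
   of theta. *)
Let divisible (N : set (C -> C)) :=
  forall f, N f -> H2s f /\ exists2 g, N g & eqT f (fun z => theta z * g z).

Let mean_bound N : divisible N -> forall k f, N f ->
  sqmod (fourier f 0) <= sqmod (fourier theta 0) ^+ k * sqnorm f.
Proof.
move=> dN; have [ht _] := hi; elim=> [|k IH] f Nf.
  have [[lf _] _] := dN f Nf; rewrite expr0 mul1r.
  have := cauchy_schwarz lf (L2_expz (R:=R) 0); rewrite -fourier_sdot.
  have -> : sqnorm (fun z : C => z ^ 0) = 1.
    by apply: complexI; rewrite -sdot_sqnorm -fourier_sdot fourier_expz eqxx; apply: complexP.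
  by rewrite mulr1.
have [[lf _] [g Ng fg]] := dN f Nf; have [hg _] := dN g Ng; have [lg _] := hg.
have hp := HooM_H2 ht hg; have [lp _] := hp.
have -> : fourier f 0 = fourier theta 0 * fourier g 0.
  rewrite (eq_fourier 0 (L2_mfun lf) (L2_mfun lp) fg).
  by rewrite hardyM_0//; exact: Hoo_H2.
have -> : sqnorm f = sqnorm g.
  apply: eq_sqnorm => //; have := inner_sqn hi; move: fg; rewrite /eqT /aeT.
  by apply: filterS2 => t /= -> h; rewrite sqmodM h mul1r.
by rewrite sqmodM exprS -mulrA ler_wpM2l ?sqmod_ge0// IH.
Qed.

Let mean0 N f : divisible N -> N f -> fourier f 0 = 0.
Proof.
move=> dN Nf; apply: sqmod_eq0; apply/eqP; rewrite eq_le sqmod_ge0 andbT.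
rewrite leNgt; apply/negP => p; have b := mean_bound dN _ Nf.
have r1 := inner_mean_lt1 hi nc; have r0 := sqmod_ge0 (fourier theta 0).
have : sqmod (fourier theta 0) ^+ k * sqnorm f @[k --> \oo] --> (0 : R).
  rewrite -(mul0r (sqnorm f)); apply: cvgM; last exact: cvg_cst.
  by apply: cvg_expr; rewrite ger0_norm.
move=> /cvgrPdist_lt /(_ _ p) [k _ /(_ k (leqnn _))] /=.
rewrite sub0r normrN ger0_norm ?mulr_ge0 ?exprn_ge0 ?sqnorm_ge0//.
by rewrite ltNge b.
Qed.

(** Each f in the family is theta^k f_k for all k, so |f^(0)| <= |theta^(0)|^k |f_k|
    vanishes; dividing the whole family by z then kills the next coefficient. *)
Lemma divisible_eq0 N f : divisible N -> N f -> eqT f (fun=> 0).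
Proof.
move=> dN Nf; have [[lf f0] _] := dN f Nf.
apply: fourier_eq0; first exact: L2_L1.
suff H (m : nat) : forall N f, divisible N -> N f -> fourier f m%:Z = 0.
  by case=> m; [exact: H Nf|exact: f0].
elim: m {N f dN Nf lf f0} => [|m IH] N f dN Nf; first exact: mean0 Nf.
pose N' := [set h : C -> C | exists2 g, N g & h = fun z => g z * z ^ (-1)].
have dN' : divisible N'.
  move=> _ [g Ng ->]; have [[lg g0] [g' Ng' gg']] := dN g Ng; split.
    apply: H2_shift => // -[[|j]|j] // _; first exact: mean0 Ng.
    exact: g0.
  exists (fun z => g' z * z ^ (-1)); first by exists g'.
  by move: gg'; rewrite /eqT /aeT; apply: filterS => t /= ->; rewrite mulrA.
have := IH N' (fun z => f z * z ^ (-1)) dN' (ex_intro2 _ _ f Nf erefl).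
by rewrite fourierM_expz opprK -PoszD addn1.
Qed.

End Divisible.

End InnerDivisibility.

Section Elimination.
Context {R : realType}.
Local Notation C := R[i].
Local Notation Hoo := (@HT R +oo%E).

(** Gaussian elimination over the integral domain H^oo: the last row is used to
    eliminate the unknown of a nonzero pivot p, by cross-multiplication since p
    need not be invertible. *)
Lemma underdetermined (m n : nat) (A : 'I_m -> 'I_n -> C -> C) : (m < n)%N ->
  (forall i j, Hoo (A i j)) ->
  exists x : 'I_n -> C -> C, [/\ forall j, Hoo (x j),
    exists j, ~ eqT (x j) (fun=> 0) &
    forall i, eqT (fun z => \sum_j A i j z * x j z) (fun=> 0)].
Proof.
elim: m n A => [|m IH] n A mn hA.
  case: n A mn hA => // n A _ _; exists (fun _ _ => 1); split.
  - by move=> j; exact: Hoo_cst.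
  - exists ord0 => h.
    have := @intT_cst R 1; rewrite (eq_intT (mfunT_cst 1) (mfunT_cst 0) h) intT_cst.
    by move=> /eqP; rewrite eq_sym oner_eq0.
  - by case.
have [row0|] := pselect (forall j, eqT (A ord_max j) (fun=> 0)).
  have [x [hx xN xA]] := IH n (fun i => A (lift ord_max i)) (ltnW mn)
    (fun i j => hA _ j).
  exists x; split=> // i; have [i'|] := unliftP ord_max i; first by move=> ->; exact: xA.
  move=> ->; apply: eqT_sum0 => j; move: (row0 j); rewrite /eqT /aeT.
  by apply: filterS => t /= ->; rewrite mul0r.
move=> /existsNP[j0 pN].
case: n A mn hA j0 pN => // n A mn hA j0 pN.
pose p := A ord_max j0.
pose B i j z := A (lift ord_max i) (lift j0 j) z * p z -
                A (lift ord_max i) j0 z * A ord_max (lift j0 j) z.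
have hB i j : Hoo (B i j).
  by apply: HooD; last apply: HooN; apply: HooM; exact: hA.
have [y [hy [j1 yN] yB]] := IH n B mn hB.
pose x j z := if unlift j0 j is Some j' then p z * y j' z
              else - \sum_j' A ord_max (lift j0 j') z * y j' z.
have xE z : x j0 z = - \sum_j' A ord_max (lift j0 j') z * y j' z.
  by rewrite /x unlift_none.
have xL j z : x (lift j0 j) z = p z * y j z by rewrite /x liftK.
have xLf j : x (lift j0 j) = fun z => p z * y j z.
  by apply/funext => z; exact: xL.
exists x; split.
- move=> j; have [j' ->|->] := unliftP j0 j.
    by rewrite xLf; apply: HooM; [exact: hA|exact: hy].
  rewrite (_ : x j0 = fun z => - \sum_j' A ord_max (lift j0 j') z * y j' z).
    by apply: HooN; apply: Hoo_sum => j'; apply: HooM; [exact: hA|exact: hy].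
  by apply/funext => z; exact: xE.
- exists (lift j0 j1); rewrite xLf => h.
  have hp : HT 2%:E p by apply: Hoo_H2; exact: hA.
  by case: (hardy_integral hp (Hoo_H2 (hy j1)) h).
- move=> i; have [i' ->|->] := unliftP ord_max i; last first.
    apply: eqT_ext => t; rewrite (bigD1_ord j0)//= xE.
    under [X in _ + X]eq_bigr do rewrite xL mulrCA.
    by rewrite -mulr_sumr mulrN addNr.
  apply: eqT_trans (yB i'); apply: eqT_ext => t; rewrite (bigD1_ord j0)//= xE.
  rewrite mulrN mulr_sumr -sumrN -big_split /=; apply: eq_bigr => j _.
  by rewrite xL /B; ring.
Qed.

End Elimination.

(** * Hankel operators in Fourier coordinates *)

Section Hankel.
Context {R : realType} {n : nat}.
Local Notation C := R[i].
Local Notation vfun := (C -> 'cV[C]_n).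
Local Notation mfun := (C -> 'M[C]_n).
Implicit Types (f g h : vfun) (Phi : mfun).

Local Notation coord i f := (fun z => f z i 0).

Definition monomial (i : 'I_n) (k : int) : vfun :=
  fun z => \col_l (if l == i then z ^ k else 0).

Lemma monomialE i k (l : 'I_n) :
  (coord l (monomial i k)) = if l == i then fun z => z ^ k else fun=> 0.
Proof. by apply/funext => z; rewrite mxE; case: ifP. Qed.

Lemma L2_monomial i k : L2 (monomial i k).
Proof.
by move=> l; rewrite monomialE; case: ifP => _; [exact: L2_expz|exact: L2_cst].
Qed.

Lemma fourier_monomial i k l j :
  fourier (coord l (monomial i k)) j = ((l == i) && (k == j))%:R.
Proof.
rewrite monomialE; case: ifP => _; first by rewrite fourier_expz.
by rewrite fourier_cst mul0r.
Qed.

Lemma dotE f g : L2 f -> L2 g -> dot f g = \sum_i sdot (coord i f) (coord i g).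
Proof.
move=> lf lg; rewrite /dot.
have [|_ ->//] := @intT_sum R 'I_n (index_enum _) xpredT
  (fun i z => f z i 0 * ((g z i 0)^*)%C).
by move=> i _; apply: L2_sdot; [exact: lf|exact: lg].
Qed.

Lemma dot_monomial f i k : L2 f -> dot f (monomial i k) = fourier (coord i f) k.
Proof.
move=> lf; rewrite dotE//; last exact: L2_monomial.
rewrite (bigD1 i)//= monomialE eqxx -fourier_sdot big1 ?addr0// => l li.
rewrite monomialE (negbTE li) /sdot -[RHS](intT_cst (R:=R) 0).
by apply: eq_circle_intT => t; rewrite conjc0 mulr0.
Qed.

Lemma H2_L2 f : H2 f -> L2 f.
Proof. by move=> hf i; have [] := hf i. Qed.

Lemma orth_H2P g : orth H2 g <->
  L2 g /\ forall i k, (0 <= k)%R -> fourier (coord i g) k = 0.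
Proof.
split=> [[lg og]|[lg g0]].
  split=> // i k k0; rewrite -dot_monomial//; apply: og => l.
  split=> [|j j0]; first exact: L2_monomial.
  rewrite fourier_monomial (_ : k == j = false) ?andbF//.
  by apply/negbTE; rewrite gt_eqF// (lt_le_trans j0).
split=> // f hf; have lf := H2_L2 hf; rewrite dotE// big1// => i _.
apply: disjoint_spectrum_orthogonal; [exact: lg|exact: lf|] => k.
have [k0|k0] := ltP k 0; last by left; exact: g0.
by right; have [_] := hf i; apply.
Qed.

Lemma orth_orth_H2P g : orth (orth H2) g <-> H2 g.
Proof.
split=> [[lg og]|hg].
  move=> i; split=> [|k k0]; first exact: lg.
  rewrite -dot_monomial//; apply: og; apply/orth_H2P; split.
    exact: L2_monomial.
  move=> l j j0; rewrite fourier_monomial (_ : k == j = false) ?andbF//.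
  by apply/negbTE; rewrite lt_eqF// (lt_le_trans k0).
have lg := H2_L2 hg; split=> // f /orth_H2P[lf f0].
rewrite dotE// big1// => i _.
apply: disjoint_spectrum_orthogonal; [exact: lg|exact: lf|] => k.
have [k0|k0] := ltP k 0; last by right; exact: f0.
by left; have [_] := hg i; apply.
Qed.

(** The projection keeps the negative Fourier coefficients of each component and
    drops the others; by Riesz-Fischer these are coefficients of a function. *)
Lemma orth_proj_exists h : L2 h ->
  exists g, orth H2 g /\ orth (orth H2) (fun z => h z - g z).
Proof.
move=> lh; pose c i (k : int) := if (k < 0)%R then fourier (coord i h) k else 0.
have P i : exists g : C -> C, LT 2%:E g /\ forall k, fourier g k = c i k.
  have [|g [lg gc _]] := @riesz_fischer R (c i) (sqnorm (coord i h)); last by exists g.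
  move=> N; apply: le_trans (bessel (lh i) (iota_uniq 0 N)).
  rewrite -(subn0 N) -/(index_iota 0 N) big_mkord subn0.
  apply: ler_sum => l _; rewrite /c; case: ifP => // _.
  by rewrite sqmod0 sqmod_ge0.
have [g hg] := choice P.
pose G : vfun := fun z => \col_i g i z.
have GE i : (coord i G) = g i by apply/funext => z; rewrite mxE.
have lG : L2 G by move=> i; rewrite GE; have [] := hg i.
exists G; split.
  apply/orth_H2P; split=> // i k k0; rewrite GE; have [_ ->] := hg i.
  by rewrite /c ltNge k0.
apply/orth_orth_H2P => i.
have -> : (coord i (fun z => h z - G z)) = fun z => h z i 0 - g i z.
  by apply/funext => z; rewrite !mxE.
have [lg gc] := hg i.
split=> [|k k0]; first by apply: L2B; [exact: lh|].
rewrite fourierB ?gc /c ?k0 ?subrr//; apply: L2_L1 => //; exact: lh.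
Qed.

Definition mulmf Phi f : vfun := fun z => Phi z *m f z.

Lemma mulmfE Phi f i : (coord i (mulmf Phi f)) = fun z => \sum_j Phi z i j * f z j 0.
Proof. by apply/funext => z; rewrite mxE. Qed.

Lemma L2_mulmf Phi f : Linf Phi -> L2 f -> L2 (mulmf Phi f).
Proof.
move=> lP lf i; rewrite mulmfE; apply: L2_sum => j _.
by apply: LooM_L2; [exact: lP|exact: lf].
Qed.

(** In Fourier coordinates H_Phi f reads off the negative coefficients of
    Phi f in reverse order. *)
Lemma hankelP Phi f : Linf Phi -> H2 f -> H2 (hankel Phi f) /\
  forall i (k : int), (0 <= k)%R ->
    fourier (coord i (hankel Phi f)) k = fourier (coord i (mulmf Phi f)) (- k - 1).
Proof.
move=> lP hf; have lh := L2_mulmf lP (H2_L2 hf).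
set g := orth_proj (orth H2) (mulmf Phi f).
have [og oh] : orth H2 g /\ orth (orth H2) (fun z => mulmf Phi f z - g z).
  exact: (xgetPex (fun=> 0) (orth_proj_exists lh)).
have [lg g0] := (orth_H2P g).1 og.
have hg := (orth_orth_H2P _).1 oh.
have fE i k : fourier (coord i (hankel Phi f)) k = fourier (coord i g) (- k - 1).
  rewrite -fourier_flip; last exact: lg.
  by apply: eq_circle_fourier => t; rewrite mxE.
have lhk : L2 (hankel Phi f).
  move=> i; have := L2_flip (lg i); apply: eq_circle_LT => t.
  by rewrite mxE.
split=> [i|i k k0].
  split=> [|k k0]; first exact: lhk.
  by rewrite fE g0//; case: k k0 => [//|k _]; rewrite NegzE opprK.
have k1 : - k - 1 < 0 by rewrite subr_lt0 (le_lt_trans _ ltr01)// oppr_le0.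
rewrite fE; have [_ /(_ _ k1)] := hg i.
have -> : (coord i (fun z => mulmf Phi f z - g z)) =
    fun z => mulmf Phi f z i 0 - g z i 0.
  by apply/funext => z; rewrite !mxE.
rewrite fourierB; [|by apply: L2_L1; exact: lh|by apply: L2_L1; exact: lg].
by move/eqP; rewrite subr_eq0 => /eqP.
Qed.

Lemma hankel_eq0P Phi f : Linf Phi -> H2 f ->
  eqT (hankel Phi f) (fun=> 0) <->
  forall i (k : int), (k < 0)%R -> fourier (coord i (mulmf Phi f)) k = 0.
Proof.
move=> lP hf; have [hh hE] := hankelP lP hf; split=> [h0 i k k0|h0].
  have k1 : 0 <= - k - 1 by case: k k0 => [//|k _]; rewrite NegzE opprK.
  have := hE i _ k1.
  rewrite (_ : - (- k - 1) - 1 = k); last by rewrite opprB opprK addrAC subrr add0r.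
  move=> <-; rewrite -[RHS](mul0r ((- k - 1) == 0)%:R) -fourier_cst.
  apply: eq_fourier; first by apply: L2_mfun; exact: (H2_L2 hh).
    exact: mfunT_cst.
  by move: h0; rewrite /eqT /aeT; apply: filterS => t /= ->; rewrite mxE.
have c0 i : eqT (coord i (hankel Phi f)) (fun=> 0).
  apply: fourier_eq0; first by apply: L2_L1; exact: (H2_L2 hh).
  move=> k; have [k0|k0] := ltP k 0; first by have [_] := hh i; apply.
  rewrite hE// h0// subr_lt0 (le_lt_trans _ ltr01)// oppr_le0//.
have := eqT_forall c0; rewrite /eqT /aeT; apply: filterS => t /= e.
by apply/matrixP => i j; rewrite ord1 e mxE.
Qed.

Definition shift (k : nat) f : vfun := fun z => z ^ k%:Z *: f z.

Lemma shiftE k f i : (coord i (shift k f)) = fun z => f z i 0 * z ^ k%:Z.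
Proof. by apply/funext => z; rewrite mxE mulrC. Qed.

Lemma H2_shiftv k f : H2 f -> H2 (shift k f).
Proof. by move=> hf i; rewrite shiftE; apply: H2_expzM; exact: hf. Qed.

Lemma fourier_mulmf_shift Phi k f i j :
  fourier (coord i (mulmf Phi (shift k f))) j =
  fourier (coord i (mulmf Phi f)) (j - k%:Z).
Proof.
rewrite -(fourierM_expz (coord i (mulmf Phi f))); congr fourier.
apply/funext => z; rewrite !mxE mulr_suml; apply: eq_bigr => l _.
by rewrite mxE mulrCA mulrC.
Qed.

End Hankel.

(** * Products of Hankel operators *)

Section HankelProduct.
Context {R : realType} {n : nat}.
Local Notation C := R[i].
Local Notation vfun := (C -> 'cV[C]_n).
Local Notation mfun := (C -> 'M[C]_n).
Local Notation coord i f := (fun z => f z i 0).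
Implicit Types (f g h : vfun) (Phi Psi : mfun).

Lemma fourier_mulmf_const Psi (w : 'cV[C]_n) l j : Linf Psi ->
  fourier (coord l (mulmf Psi (fun=> w))) j =
  \sum_i fourier (fun z => Psi z l i) j * w i 0.
Proof.
move=> lP; have lPs i : LT 1%E (fun z => Psi z l i).
  by apply: L2_L1; apply: Loo_L2; exact: lP.
rewrite mulmfE fourier_sum; last first.
  move=> i; have := L1Z (w i 0) (lPs i).
  by apply: eq_circle_LT => t; rewrite mulrC.
apply: eq_bigr => i _; rewrite mulrC -fourierZ//.
by apply: eq_circle_fourier => t; rewrite mulrC.
Qed.

Lemma H2_const (w : 'cV[C]_n) : H2 (fun=> w).
Proof. by move=> i; apply: Hoo_H2; exact: Hoo_cst. Qed.

(** The constant term of the Hardy function H_Phi f. *)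
Definition hankel_value Phi f : 'cV[C]_n :=
  \col_i fourier (coord i (mulmf Phi f)) (-1).

(** Since the range of H_Phi is invariant under the backward shift, a vector
    function g = H_Phi f splits as g(0) + z H_Phi(z f); when H_Psi kills the
    range, it therefore also kills the constant g(0). *)
Lemma hankel_value_ker Phi Psi f : Linf Phi -> Linf Psi ->
  zero_op (fun f => hankel Psi (hankel Phi f)) -> H2 f ->
  eqT (hankel Psi (fun=> hankel_value Phi f)) (fun=> 0).
Proof.
move=> lP lS hz hf; set w := hankel_value Phi f.
have hf1 := H2_shiftv 1 hf.
have [hg gE] := hankelP lP hf; have [hg' gE'] := hankelP lP hf1.
set g := hankel Phi f in hg gE *; set g' := hankel Phi (shift 1 f) in hg' gE' *.
have ker_g := (hankel_eq0P lS hg).1 (hz f hf).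
have ker_g' := (hankel_eq0P lS hg').1 (hz _ hf1).
clearbody g g'.
have gsplit i : eqT (coord i g) (fun z => w i 0 + g' z i 0 * z ^ 1).
  have [lg g0] := hg i; have [lg' g0'] := hg' i.
  have l1 : LT 1%E (fun=> w i 0 : C) by apply: L2_L1; exact: L2_cst.
  have l2 : LT 1%E (fun z => g' z i 0 * z ^ 1) by apply: L1M_expz; exact: L2_L1.
  apply: fourier_inj; [exact: L2_L1|exact: L1D|move=> k].
  rewrite fourierD// fourier_cst (fourierM_expz (coord i g')).
  have [k0|k0|->] := ltgtP k 0.
  - have k1 : k - 1 < 0 by rewrite subr_lt0 (lt_trans k0).
    by rewrite (g0 _ k0) (g0' _ k1) mulr0 addr0.
  - rewrite mulr0 add0r gE ?ltW// gE'; last by case: k k0 => [[|k]|k].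
    by rewrite fourier_mulmf_shift; congr fourier; ring.
  - rewrite mulr1 g0' ?addr0// gE// /w mxE; congr fourier.
apply/(hankel_eq0P lS (H2_const w)) => l j j0.
have lSg := L2_mulmf lS (H2_L2 hg); have lSg' := L2_mulmf lS (H2_L2 hg').
have lSw := L2_mulmf lS (H2_L2 (H2_const w)).
have l2 : LT 2%:E (fun z => mulmf Psi g' z l 0 * z ^ 1) by apply: L2M_expz; exact: lSg'.
have split : eqT (coord l (mulmf Psi g))
    (fun z => mulmf Psi (fun=> w) z l 0 + mulmf Psi g' z l 0 * z ^ 1).
  have := eqT_forall gsplit; rewrite /eqT /aeT; apply: filterS => t /= e.
  rewrite !mxE mulr_suml -big_split /=; apply: eq_bigr => i _.
  by rewrite e mulrDr mulrA.
have := eq_fourier j (L2_mfun (lSg l)) (mfunTD (L2_mfun (lSw l)) (L2_mfun l2)) split.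
rewrite ker_g// fourierD; [|exact: L2_L1 (lSw l)|exact: L2_L1].
rewrite (fourierM_expz (coord l (mulmf Psi g'))) ker_g' ?addr0//.
by rewrite ltrBlDr (lt_trans j0).
Qed.

Lemma conjc_eq0_inv (c : C) : (c^*)%C = 0 -> c = 0.
Proof. by move=> e; rewrite -[LHS]conjcK e conjc0. Qed.

(** For c nonzero, theta g = c would make the conjugate of theta, which is then a
    multiple of g, analytic as well as theta. *)
Lemma const_not_divisible (theta g : C -> C) (c : C) :
  inner_function theta -> nonconstant theta -> HT 2%:E g ->
  eqT (fun=> c) (fun z => theta z * g z) -> c = 0.
Proof.
move=> hi nc [lg g0] cg; apply: contrapT => /eqP cN; apply: nc.
have [[loo th0] _] := hi; have lt := Loo_L2 loo; have l1 := L2_L1 lt.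
have gE : eqT g (fun z => c * (theta z)^*%C).
  have := inner_sqn hi; move: cg; rewrite /eqT /aeT.
  apply: filterS2 => t /= -> s1.
  by rewrite mulrAC sqmodE s1 mul1r.
have ltc : LT 2%:E (fun z => (theta z)^*%C) by exact: L2_conj.
exists (fourier theta 0); apply: fourier_inj => //.
  by apply: L2_L1; exact: L2_cst.
move=> k; rewrite fourier_cst; have [k0|k0|->] := ltgtP k 0.
- by rewrite th0// mulr0.
- rewrite mulr0.
  have kN : - k < 0 by rewrite oppr_lt0.
  have := eq_fourier (- k) (L2_mfun lg) (L2_mfun (L2Z c ltc)) gE.
  rewrite g0// fourierZ; last exact: L2_L1.
  rewrite fourierJ// opprK => /esym/eqP; rewrite mulf_eq0 (negbTE cN) orFb.
  by move=> /eqP; exact: conjc_eq0_inv.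
- by rewrite mulr1.
Qed.

(** Multiplying f by z^k brings the coefficient of index -k-1 of Phi f to -1, so
    the values H_Phi f (0) for all f control all of H_Phi. *)
Lemma zero_op_hankel_value Phi : Linf Phi ->
  (forall f, H2 f -> hankel_value Phi f = 0) -> zero_op (hankel Phi).
Proof.
move=> lP h f hf; apply/(hankel_eq0P lP hf) => i [//|k] _.
have := h _ (H2_shiftv k hf) => /matrixP /(_ i 0); rewrite !mxE.
rewrite fourier_mulmf_shift => <-; congr fourier.
by rewrite NegzE -opprD -PoszD add1n.
Qed.

(** The constants H_Phi f (0) lie in ker H_Psi, hence are divisible by theta,
    hence vanish. *)
Lemma hankelM_eq0_singular_left Phi Psi : Linf Phi -> Linf Psi ->
  tensored_scalar_singularity Psi ->
  zero_op (fun f => hankel Psi (hankel Phi f)) -> zero_op (hankel Phi).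
Proof.
move=> lP lS [theta [hi nc hker]] hz; apply: zero_op_hankel_value => // f hf.
have [g hg wg] : mulH2 theta (fun=> hankel_value Phi f).
  by apply: hker; split; [exact: H2_const|exact: hankel_value_ker].
apply/matrixP => i j; rewrite ord1 [RHS]mxE.
apply: (const_not_divisible hi nc (hg i)).
by move: wg; rewrite /eqT /aeT; apply: filterS => t /= ->; rewrite mxE.
Qed.

Lemma zero_op_analytic Psi : Linf Psi ->
  (forall l i (j : int), (j < 0)%R -> fourier (fun z => Psi z l i) j = 0) ->
  zero_op (hankel Psi).
Proof.
move=> lS h f hf; apply/(hankel_eq0P lS hf) => l j j0.
have hP i : HT +oo%E (fun z => Psi z l i) by split; [exact: lS|exact: h].
have hPf i := HooM_H2 (hP i) (hf i).
rewrite mulmfE fourier_sum; last by move=> i; apply: L2_L1; case: (hPf i).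
by rewrite big1// => i _; have [_] := hPf i; apply.
Qed.

(** Clearing denominators row by row turns the system into one over H^oo. *)
Lemma bounded_type_null_vector Phi (i0 : 'I_n) : bounded_type_mx Phi ->
  exists x : vfun, [/\ H2 x, exists j, ~ eqT (coord j x) (fun=> 0) &
    forall i, i != i0 -> eqT (coord i (mulmf Phi x)) (fun=> 0)].
Proof.
move=> bt.
have /choice[u hu] : forall ij : 'I_n * 'I_n, exists uv : (C -> C) * (C -> C),
    [/\ HT +oo%E uv.1, HT +oo%E uv.2 &
     aeT [set z | uv.2 z != 0 /\ Phi z ij.1 ij.2 = uv.1 z / uv.2 z]].
  by move=> [i j]; have [p [q H]] := bt i j; exists (p, q).
pose q i z := \prod_j (u (i, j)).2 z.
pose A i j z := (u (i, j)).1 z * \prod_(k | k != j) (u (i, k)).2 z.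
have hA i j : HT +oo%E (A i j).
  apply: HooM; first by have [] := hu (i, j).
  by apply: Hoo_prod => k; have [] := hu (i, k).
have Aq i : aeT [set z | q i z != 0 /\ forall j, A i j z = q i z * Phi z i j].
  have : aeT [set z | forall j, (u (i, j)).2 z != 0 /\
      Phi z i j = (u (i, j)).1 z / (u (i, j)).2 z].
    by rewrite /aeT; apply: filter_forall => j; have [] := hu (i, j).
  rewrite /aeT; apply: filterS => t /= h; split.
    by rewrite /q; apply/prodf_neq0 => j _; have [] := h j.
  move=> j; rewrite /A /q [in RHS](bigD1 j)//; have [v0 ->] := h j.
  by rewrite [RHS]mulrAC [X in _ = X * _]mulrC divfK.
have lt : (n.-1 < n)%N by case: n i0 => [[]|].
have [x [hx xN xA]] := underdetermined lt (fun i j => hA (lift i0 i) j).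
pose X : vfun := fun z => \col_j x j z.
have XE j : coord j X = x j by apply/funext => z; rewrite mxE.
exists X; split.
- by move=> j; rewrite XE; exact: Hoo_H2.
- by have [j xj] := xN; exists j; rewrite XE.
- move=> i; have [i' -> _|->] := unliftP i0 i; last by rewrite eqxx.
  move: (Aq (lift i0 i')) (xA i'); rewrite /eqT /aeT; apply: filterS2.
  move=> t /= [q0 AE]; rewrite mxE => s0.
  apply: (mulfI q0); rewrite mulr0 -[RHS]s0 mulr_sumr; apply: eq_bigr => j _.
  by rewrite AE mxE mulrA.
Qed.

(** If Psi had a nonzero row r of coefficients of some negative index, r would
    annihilate all vectors H_Phi f (0), which makes r Phi f analytic for every f.
    Let i0 be an index with r i0 nonzero. When the entries of Phi x other than the
    one of index i0 vanish, that entry is then analytic, so that x is in ker H_Phi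
    and x = theta y; and y satisfies the same equations. Hence such x are divisible
    by all powers of theta and vanish, whereas Phi, being of bounded type, has a
    nonzero one. *)
Lemma hankelM_eq0_singular_right Phi Psi : Linf Phi -> bounded_type_mx Phi -> Linf Psi ->
  tensored_scalar_singularity Phi ->
  zero_op (fun f => hankel Psi (hankel Phi f)) -> zero_op (hankel Psi).
Proof.
move=> lP bt lS [theta [hi nc hker]] hz; apply: zero_op_analytic => // l i0 j0 j0N.
apply: contrapT => /eqP r0; pose r i := fourier (fun z => Psi z l i) j0.
have annih f (k : int) : H2 f -> (k < 0)%R ->
    \sum_i r i * fourier (coord i (mulmf Phi f)) k = 0.
  move=> hf; case: k => // k _; have hfk := H2_shiftv k hf.
  have := (hankel_eq0P lS (H2_const _)).1 (hankel_value_ker lP lS hz hfk) l j0 j0N.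
  rewrite fourier_mulmf_const// => e; rewrite -[RHS]e; apply: eq_bigr => m _.
  rewrite mxE fourier_mulmf_shift; congr (_ * fourier _ _).
  by rewrite NegzE -opprD -PoszD add1n.
pose N : set vfun := [set x | H2 x /\
  forall i, i != i0 -> eqT (coord i (mulmf Phi x)) (fun=> 0)].
have Nker x : N x -> ker_hankel Phi x.
  move=> [hx x0]; split=> //; apply/(hankel_eq0P lP hx).
  have z0 i k : i != i0 -> fourier (coord i (mulmf Phi x)) k = 0.
    move=> ii0; rewrite -[RHS](mul0r (k == 0)%:R) -fourier_cst.
    apply: eq_fourier; [|exact: mfunT_cst|exact: x0].
    exact: L2_mfun (L2_mulmf lP (H2_L2 hx) i).
  move=> i k k0; have [->|] := eqVneq i i0; last exact: z0.
  have := annih x k hx k0; rewrite (bigD1 i0)//= big1 ?addr0.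
    by move=> /eqP; rewrite mulf_eq0 (negbTE r0) => /eqP.
  by move=> m mi; rewrite z0// mulr0.
have Ndiv x : N x -> exists2 y, N y & eqT x (fun z => theta z *: y z).
  move=> Nx; have [y hy xy] := hker x (Nker x Nx); exists y => //; split=> // i ii0.
  have [_ /(_ i ii0)] := Nx; move: xy (inner_neq0 hi); rewrite /eqT /aeT.
  apply: filterS3 => t /= xe th0; rewrite !mxE xe => s0.
  apply: (mulfI th0); rewrite mulr0 -[RHS]s0 mulr_sumr; apply: eq_bigr => m _.
  by rewrite mxE mulrCA.
have [x [hx [m xm] x0]] := bounded_type_null_vector i0 bt.
apply: xm; apply: (@divisible_eq0 R theta hi nc [set (coord m y) | y in N]).
  move=> _ [y Ny <-]; split; first by have [hy _] := Ny; exact: hy.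
  have [y' Ny' yy'] := Ndiv y Ny; exists (coord m y'); first by exists y'.
  by move: yy'; rewrite /eqT /aeT; apply: filterS => t /= ->; rewrite mxE.
by exists x.
Qed.

End HankelProduct.

Theorem theorem5p4 (R : realType) (n : nat) (hn : (0 < n)%N)
    (Phi Psi : R[i] -> 'M[R[i]]_n)
    (hPhi : Linf Phi) (btPhi : bounded_type_mx Phi)
    (hPsi : Linf Psi) (btPsi : bounded_type_mx Psi)
    (hsing : tensored_scalar_singularity Phi \/
             tensored_scalar_singularity Psi) :
  zero_op (fun f => hankel Psi (hankel Phi f)) ->
  zero_op (hankel Phi) \/ zero_op (hankel Psi).
Proof.
move=> hz; case: hsing => hs.
- by right; exact: hankelM_eq0_singular_right hz.
- by left; exact: hankelM_eq0_singular_left hz.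
Qed.
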